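(* Let $p\ge 5$ and $N\ge 5$ be prime numbers with $N\equiv 1\pmod p$. Suppose that $N=\frac{a^p+b^p}{a+b}$ for some $a,b\in\mathbf{Z}$. Then $$\log(a+b)\equiv -8\cdot\sum_{k=1}^{\frac{N-1}{2}}k\cdot\log(k)\pmod p .$$
   Context: Let $\nu$ be the $p$-adic valuation of $N-1$ and fix a surjective group homomorphism $\log:(\mathbf{Z}/N\mathbf{Z})^\times\to\mathbf{Z}/p^\nu\mathbf{Z}$ (here only its reduction modulo $p$ is used); for an integer $x$ prime to $N$, $\log(x)$ means $\log(x \bmod N)$. It is implicit that $a+b\ne 0$, and $a+b$ is then automatically prime to $N$. *)

(* Defs.v *)
From HB Require Import structures.
From mathcomp Require Import all_boot all_order all_algebra all_fingroup.

Set Implicit Arguments.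
Unset Strict Implicit.
Unset Printing Implicit Defensive.

Import GRing.Theory.
Local Open Scope ring_scope.

(* The class of x in (Z/NZ)^*. It is meaningful only for x prime to N; other
   integers are sent to the junk value 1. *)
Definition unit_class (N : nat) (x : int) : {unit 'Z_N} :=
  insubd (1%g : {unit 'Z_N}) (x%:~R : 'Z_N).

(* The integer representative in [0, m) of log (x mod N), for
   log : (Z/NZ)^* -> Z/mZ, the target being seen as an additive group.
   When p divides m, its class modulo p is the reduction of log x modulo p. *)
Definition log_repr (N m : nat)
    (log : {morphism [set: {unit 'Z_N}] >-> 'Z_m}) (x : int) : int :=
  (nat_of_ord (log (unit_class N x)))%:Z.

(* Main.v *)
Require Import Defs.
From HB Require Import structures.
From mathcomp Require Import all_boot all_order all_algebra all_fingroup.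
From mathcomp Require Import all_field.
From mathcomp Require Import ring zify.

Set Implicit Arguments.
Unset Strict Implicit.
Unset Printing Implicit Defensive.

Import Order.TTheory GRing.Theory Num.Theory.
Import Pdiv.Ring.
Local Open Scope ring_scope.

(** Write n = (N - 1) / p, z = - a / b (a primitive p-th root of unity mod N),
    zeta for a complex p-th root of unity and <u> for the residue of u in
    [0, p).  For 1 < j < p, let J_j be the Jacobi sum
    sum_x zeta^(j ind(1 - x) - ind x), where z^(ind x) = x^n in F_N.
    Since N = prod_(k != 0) (a + zeta^k b), both J_j and
    Q_j = prod_(k : <j/k> < <1/k>) (a + zeta^k b) have absolute value sqrt N,
    and J_j vanishes under every reduction zeta |-> z^s under which Q_j does.
    Hence J_j / Q_j is an algebraic integer all of whose conjugates have
    absolute value 1: it is +- zeta^e, with e determined by J_j modulo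
    (1 - zeta)^2.  Reducing zeta |-> z gives
    log 'C(j n, n) = sum_(k : <j/k> < <1/k>) (log (a + z^k b) - t k log z),
    where t = b / (a + b) mod p.

    On the other side, k -> N - k and k -> 2k turn -8 sum k log k into
    6 sum_(k < N) (k^2 - k) log k; substituting p k for k replaces the weight
    by i^2 + i with i = floor(p k / N), which is constant on blocks of length n,
    and the sum becomes sum_j (6 j^2 - 6 j + 1) log 'C(j n, n).  The weights
    attached to a given k add up to k - 1, and
    sum_(k != 0) (k - 1) log (a + z^k b) collapses to log (a + b). *)

(* Otherwise simplification turns exponents in 'F_p into reductions mod p. *)
Local Arguments nat_of_ord : simpl never.

(** * Roots of unity indexed by F_p *)

Section RootsOfUnity.

Variables (p : nat) (p_prime : prime p).

Lemma big_Fp [R : Type] [idx : R] [op : R -> R -> R] (f : nat -> R) :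
  \big[op/idx]_(k : 'F_p) f k = \big[op/idx]_(k < p) f k.
Proof. by rewrite -[LHS](big_mkord xpredT f) Fp_cast // big_mkord. Qed.

Lemma natr_Fp (k : 'F_p) : (k%:R : 'F_p) = k.
Proof. exact: natr_Zp. Qed.

Lemma ltn_Fp (k : 'F_p) : (k < p)%N.
Proof. by case: k => k /=; rewrite Fp_cast. Qed.

Lemma val_Fp1 : nat_of_ord (1 : 'F_p) = 1%N.
Proof. by rewrite -[1]/(1%:R) val_Fp_nat // modn_small // prime_gt1. Qed.

Lemma sum_Fp_neq0 (V : nmodType) (f : nat -> V) :
  \sum_(x : 'F_p | x != 0) f x = \sum_(1 <= k < p) f k.
Proof.
rewrite big_mkcond /= (eq_bigr (fun x : 'F_p => if (0 < x)%N then f x else 0)).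
  rewrite (big_Fp (fun k => if (0 < k)%N then f k else 0)).
  rewrite -(big_mkord xpredT (fun k => if (0 < k)%N then f k else 0)).
  rewrite (big_ltn (prime_gt0 p_prime)) /= add0r.
  by apply: eq_big_nat => k /andP[k1 _]; rewrite k1.
by move=> x _; rewrite lt0n.
Qed.

Lemma natr_p : p%:R = 0 :> 'F_p.
Proof. exact: pcharf0 (pchar_Fp p_prime). Qed.

Lemma natr_Fp_eq0 (m : nat) : ((m%:R : 'F_p) == 0) = (p %| m)%N.
Proof. by rewrite -(dvdn_pcharf (pchar_Fp p_prime)). Qed.

Lemma expr_Fp_nat (R : pzSemiRingType) (x : R) (m : nat) :
  x ^+ p = 1 -> x ^+ (m%:R : 'F_p) = x ^+ m.
Proof. by move=> xp; rewrite val_Fp_nat // expr_mod. Qed.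

Lemma expr_FpM (R : pzSemiRingType) (x : R) (k l : 'F_p) :
  x ^+ p = 1 -> x ^+ (k * l)%R = x ^+ k ^+ l.
Proof.
by move=> xp; rewrite -{1}(natr_Fp k) -{1}(natr_Fp l) -natrM expr_Fp_nat // exprM.
Qed.

Lemma expr_FpD (R : pzSemiRingType) (x : R) (k l : 'F_p) :
  x ^+ p = 1 -> x ^+ (k + l)%R = x ^+ k * x ^+ l.
Proof.
by move=> xp; rewrite -{1}(natr_Fp k) -{1}(natr_Fp l) -natrD expr_Fp_nat // exprD.
Qed.

Lemma expr_FpN (R : fieldType) (x : R) (k : 'F_p) :
  x ^+ p = 1 -> x ^+ (- k)%R = (x ^+ k)^-1.
Proof.
move=> xp; have xk : x ^+ k * x ^+ (- k)%R = 1 by rewrite -expr_FpD // subrr.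
by apply/esym/mulr1_eq.
Qed.

Lemma val_FpN (k : 'F_p) : k != 0 -> nat_of_ord (- k) = (p - k)%N.
Proof.
move=> k0; have kp := ltn_Fp k.
have -> : - k = (p - k)%:R by rewrite natrB ?(ltnW kp) // natr_p natr_Fp sub0r.
have k_gt0 : (0 < k)%N by rewrite lt0n.
by rewrite val_Fp_nat // modn_small //; lia.
Qed.

Lemma expr_Fp_exp1 (R : pzSemiRingType) (x : R) (k : nat) :
  x ^+ p = 1 -> (x ^+ k) ^+ p = 1.
Proof. by move=> xp; rewrite exprAC xp expr1n. Qed.

Lemma prime_primitive_root (R : idomainType) (x : R) :
  x ^+ p = 1 -> x != 1 -> p.-primitive_root x.
Proof.
move=> xp x1; have [m xm] := prim_order_exists (prime_gt0 p_prime) xp.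
case/primeP: p_prime => _ mp /mp /orP[]/eqP Em; last by rewrite -Em.
by move: x1; rewrite -(prim_expr_order xm) Em expr1 eqxx.
Qed.

Lemma expr_Fp_inj (R : idomainType) (x : R) :
  p.-primitive_root x -> injective (fun k : 'F_p => x ^+ k).
Proof.
move=> xp k l /eqP; rewrite (eq_prim_root_expr xp) !modn_small ?ltn_Fp //.
by move/eqP/val_inj.
Qed.

Lemma sum_expr_Fp (R : idomainType) (x : R) :
  x ^+ p = 1 -> x != 1 -> \sum_(k : 'F_p) x ^+ k = 0.
Proof.
move=> xp x1; rewrite (big_Fp (fun k => x ^+ k)); apply/eqP.
move: (subrX1 x p); rewrite xp subrr => /esym/eqP.
by rewrite mulf_eq0 subr_eq0 (negPf x1).
Qed.

Lemma sum_expr_FpM (R : idomainType) (x : R) (k : 'F_p) :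
  p.-primitive_root x -> \sum_(s : 'F_p) x ^+ (s * k)%R = (k == 0)%:R * p%:R.
Proof.
move=> xp; have x1 := prim_expr_order xp.
have [->|k0] := eqVneq k 0.
  under eq_bigr do rewrite mulr0 expr0.
  by rewrite sumr_const card_Fp // mul1r.
rewrite mul0r; transitivity (\sum_(s : 'F_p) (x ^+ k) ^+ s).
  by apply: eq_bigr => s _; rewrite mulrC expr_FpM.
apply: sum_expr_Fp; rewrite ?expr_Fp_exp1 //.
by apply: contra_neq k0 => xk; apply: (expr_Fp_inj xp); rewrite /= xk expr0.
Qed.

Lemma poly_eq0_at_roots (R : idomainType) (x : R) (f : {poly R}) :
  p.-primitive_root x -> (size f <= p.-1)%N ->
  (forall k : 'F_p, k != 0 -> f.[x ^+ k] = 0) -> f = 0.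
Proof.
move=> xp sf fx.
apply: (@roots_geq_poly_eq0 _ f [seq x ^+ (k : 'F_p) | k <- enum (predC1 (0 : 'F_p))]).
- by apply/allP => y /mapP[k]; rewrite mem_enum => k0 ->; apply/rootP/fx.
- by rewrite map_inj_uniq ?enum_uniq //; exact: expr_Fp_inj.
- by rewrite size_map -cardE cardC1 card_Fp.
Qed.

End RootsOfUnity.

(** * Units of Z[zeta] of absolute value 1 *)

(* On average, a row of the double sum is smaller than 2. *)
Lemma int_almost_constant (I : finType) (u : I -> int) :
    (1 < #|I|)%N ->
    \sum_i \sum_j (u i - u j) ^+ 2 = 2 * (#|I|%:R - 1) ->
  exists c (i0 : I) (e : int),
    e ^+ 2 = 1 /\ forall i, u i = c + e * (i == i0)%:R.
Proof.
move=> I_gt1 sumE.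
pose R i := \sum_j (u i - u j) ^+ 2.
have R_ge0 i : 0 <= R i by apply: sumr_ge0 => j _; exact: sqr_ge0.
have [i Ri] : exists i, R i <= 1.
  apply/existsP; apply: contraLR isT => /existsPn R_gt1.
  have c2 : \sum_(i : I) (2 : int) = 2 * #|I|%:R by rewrite sumr_const mulr_natr.
  have : \sum_(i : I) (2 : int) <= \sum_i R i.
    by apply: ler_sum => i _; move: (R_gt1 i); lia.
  rewrite c2 sumE; lia.
(* A row sum at most 1 leaves room for a single value different from [u i], at distance 1. There is
   one, since otherwise the double sum would be 0 and not 2 (#|I| - 1) > 0. *)
have [|[j uj]] : (forall j, u j = u i) \/ exists j, u j != u i.
  have [/forallP h|/forallPn[j h]] := boolP [forall j, u j == u i].
    by left=> j; apply/eqP.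
  by right; exists j.
  move=> uc; move: sumE; rewrite big1 => [|k _]; last first.
    by rewrite big1 // => l _; rewrite !uc subrr expr0n.
  by lia.
have rest_ge0 : 0 <= \sum_(k | k != j) (u i - u k) ^+ 2.
  by apply: sumr_ge0 => k _; exact: sqr_ge0.
move: Ri; rewrite /R (bigD1 j) //= => Ri.
have d_gt0 : 0 < (u i - u j) ^+ 2 by rewrite exprn_even_gt0 //= subr_eq0 eq_sym.
have aux (x y : int) : 0 < x -> 0 <= y -> x + y <= 1 -> x = 1 /\ y = 0 by lia.
have [d1 /eqP rest0] := aux _ _ d_gt0 rest_ge0 Ri.
exists (u i), j, (u j - u i); split; first by rewrite -sqrrN opprB.
move=> k; have [->|kj] := eqVneq k j; first by rewrite mulr1 addrC subrK.
move: rest0; rewrite psumr_eq0 => [/allP/(_ k)|l _]; last exact: sqr_ge0.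
rewrite mem_index_enum kj sqrf_eq0 subr_eq0 => /(_ isT) /eqP <-.
by rewrite mulr0 addr0.
Qed.

Section IntegralUnits.

Variables (p : nat) (p_prime : prime p) (zeta : algC).
Hypothesis zetaP : p.-primitive_root zeta.

Let zetap : zeta ^+ p = 1 := prim_expr_order zetaP.

(** Plancherel on F_p, by orthogonality of characters. Complex conjugation is expressed as s |-> -s,
    here and below. *)
Lemma parseval_Fp (u : 'F_p -> int) :
  \sum_(s : 'F_p) (\sum_(k : 'F_p) (u k)%:~R * zeta ^+ (s * k)%R) *
                  (\sum_(k : 'F_p) (u k)%:~R * zeta ^+ (- s * k)%R)
  = (\sum_k u k ^+ 2)%:~R * p%:R :> algC.
Proof.
transitivity (\sum_(k : 'F_p) \sum_(l : 'F_p) (u k)%:~R * (u l)%:~R *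
    (\sum_(s : 'F_p) zeta ^+ (s * (k - l))%R)).
  under eq_bigr => s _ do rewrite big_distrlr.
  rewrite exchange_big /=; apply: eq_bigr => k _.
  rewrite exchange_big /=; apply: eq_bigr => l _.
  rewrite mulr_sumr; apply: eq_bigr => s _.
  by rewrite mulrBr -mulNr expr_FpD // mulrACA.
rewrite rmorph_sum /= mulr_suml; apply: eq_bigr => k _.
rewrite (bigD1 k) //= subrr sum_expr_FpM // eqxx mul1r rmorphXn /= expr2.
rewrite big1 ?addr0 // => l lk.
by rewrite sum_expr_FpM // subr_eq0 eq_sym (negPf lk) mul0r mulr0.
Qed.

(** An elementary form of Kronecker's theorem. With A and B the sums of u_k and u_k^2, Parseval
    gives p B = A^2 + (p - 1), so the (u_i - u_j)^2 add up to 2 p B - 2 A^2 = 2 (p - 1). By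
    [int_almost_constant], u is then a constant plus a signed delta, and the constant is killed by 1
    + zeta + ... + zeta^(p-1) = 0. *)
Lemma integral_unit_monomial (u : 'F_p -> int) :
    (forall s : 'F_p, s != 0 ->
      (\sum_(k : 'F_p) (u k)%:~R * zeta ^+ (s * k)%R) *
      (\sum_(k : 'F_p) (u k)%:~R * zeta ^+ (- s * k)%R) = 1) ->
  exists (e : int) (k0 : 'F_p), e ^+ 2 = 1 /\
    forall s : 'F_p, s != 0 ->
      \sum_(k : 'F_p) (u k)%:~R * zeta ^+ (s * k)%R
        = e%:~R * zeta ^+ (s * k0)%R.
Proof.
move=> uU; set A := \sum_k u k; set B := \sum_k u k ^+ 2.
have pars : B * p%:R = A ^+ 2 + (p%:R - 1).
  apply: (@intr_inj algC); rewrite rmorphM rmorph_nat /= -parseval_Fp.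
  rewrite (bigD1 0) //= [X in _ + X](eq_bigr (fun=> 1)) => [|s s0]; last exact: uU.
  rewrite sumr_const cardC1 card_Fp // rmorphD rmorphB rmorph_nat /=.
  rewrite -subn1 natrB ?prime_gt0 //; congr (_ + _).
  rewrite rmorphXn /= expr2 /A rmorph_sum /=.
  by congr (_ * _); apply: eq_bigr => k _; rewrite ?oppr0 mul0r expr0 mulr1.
have [||c [k0 [e [e1 ue]]]] := @int_almost_constant _ u.
- by rewrite card_Fp // prime_gt1.
- rewrite card_Fp //.
  transitivity (\sum_(i : 'F_p) (u i ^+ 2 * p%:R - 2 * u i * A + B)).
    apply: eq_bigr => i _; under eq_bigr do rewrite sqrrB.
    rewrite big_split /= sumrB sumr_const card_Fp // -mulr_natr.
    by rewrite -/B sumrMnl -mulr_sumr -/A -mulr_natr; congr (_ - _ + _); ring.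
  rewrite big_split /= sumrB -!mulr_suml -mulr_sumr sumr_const card_Fp //.
  rewrite -/A -/B -[B *+ _]mulr_natr pars; ring.
exists e, k0; split=> // s s0.
under eq_bigr => k _ do rewrite ue rmorphD rmorphM rmorph_nat /= mulrDl.
rewrite big_split /= -mulr_sumr.
have -> : \sum_(k : 'F_p) zeta ^+ (s * k)%R = 0.
  under eq_bigr do rewrite mulrC.
  by rewrite sum_expr_FpM // (negPf s0) mul0r.
rewrite mulr0 add0r (bigD1 k0) //= eqxx mulr1 big1 ?addr0 // => k kk.
by rewrite (negPf kk) mulr0 mul0r.
Qed.

End IntegralUnits.

(** * Division by the p-th cyclotomic polynomial over Z *)

Definition Phi (p : nat) : {poly int} := \poly_(i < p) 1.

Lemma size_Phi (p : nat) : size (Phi p) = p.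
Proof. by case: p => [|p]; rewrite ?poly_def ?big_ord0 ?size_poly0 // size_poly_eq. Qed.

Lemma Phi_monic (p : nat) : (0 < p)%N -> Phi p \is monic.
Proof.
by move=> p_gt0; rewrite monicE /lead_coef size_Phi coef_poly prednK // leqnn.
Qed.

Lemma horner_Phi (R : comNzRingType) (p : nat) (x : R) :
  (map_poly intr (Phi p)).[x] = \sum_(i < p) x ^+ i.
Proof.
rewrite /Phi poly_def rmorph_sum horner_sum; apply: eq_bigr => i _.
by rewrite scale1r /= map_polyXn hornerXn.
Qed.

Section ModPhi.

Variables (p : nat) (p_prime : prime p).

Lemma horner_Phi_eq0 (R : idomainType) (x : R) (s : 'F_p) :
  p.-primitive_root x -> s != 0 -> (map_poly intr (Phi p)).[x ^+ s] = 0.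
Proof.
move=> xp s0; rewrite horner_Phi -(big_Fp p_prime (fun i => (x ^+ s) ^+ i)).
under eq_bigr do rewrite -expr_FpM ?(prim_expr_order xp) // mulrC.
by rewrite sum_expr_FpM // (negPf s0) mul0r.
Qed.

Lemma rmodp_Phi_size (f : {poly int}) : (size (rmodp f (Phi p)) <= p.-1)%N.
Proof.
rewrite -ltnS prednK ?prime_gt0 // -[X in (_ < X)%N]size_Phi.
by rewrite Pdiv.Ring.ltn_rmodpN0 // monic_neq0 // Phi_monic ?prime_gt0.
Qed.

Lemma divp_Phi (f : {poly int}) :
  f = rdivp f (Phi p) * Phi p + rmodp f (Phi p).
Proof. by apply: Pdiv.RingMonic.rdivp_eq; rewrite Phi_monic ?prime_gt0. Qed.

Lemma horner_rmodp_Phi (R : idomainType) (x : R) (s : 'F_p) (f : {poly int}) :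
    p.-primitive_root x -> s != 0 ->
  (map_poly intr (rmodp f (Phi p))).[x ^+ s] = (map_poly intr f).[x ^+ s].
Proof.
move=> xp s0; rewrite [in RHS](divp_Phi f) rmorphD rmorphM /= hornerD hornerM.
by rewrite horner_Phi_eq0 // mulr0 add0r.
Qed.

(** The remainder has degree less than p - 1 and vanishes at the p - 1 primitive p-th roots of
    unity. *)
Lemma dvdp_Phi (zeta : algC) (f : {poly int}) :
    p.-primitive_root zeta ->
    (forall s : 'F_p, s != 0 -> (map_poly intr f).[zeta ^+ s] = 0) ->
  f = rdivp f (Phi p) * Phi p.
Proof.
move=> zp f0; rewrite [LHS]divp_Phi; suff -> : rmodp f (Phi p) = 0 by rewrite addr0.
apply: (map_inj_poly (f := intr : int -> algC)) => //; first exact: intr_inj.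
rewrite rmorph0; apply: (poly_eq0_at_roots p_prime zp) => [|s s0].
  by rewrite size_map_inj_poly ?rmodp_Phi_size //; exact: intr_inj.
by rewrite horner_rmodp_Phi // f0.
Qed.

Section NormNElements.

Variables (N : nat) (N_prime : prime N) (zeta : algC) (z : 'F_N).
Hypotheses (zetaP : p.-primitive_root zeta) (zP : p.-primitive_root z).

(** N splits completely in Z[zeta], and the evaluations at z^s are the reductions at the primes
    above N. Vanishing at all of them forces divisibility by N: modulo N the remainder has p - 1
    roots and degree less than p - 1. *)
Lemma rmodp_Phi_dvd (f : {poly int}) (i : nat) :
    (forall s : 'F_p, s != 0 -> (map_poly intr f).[z ^+ s] = 0) ->
  (N %| (rmodp f (Phi p))`_i)%Z.
Proof.
move=> f0; rewrite (dvdz_pcharf (pchar_Fp N_prime)) -coef_map.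
suff -> : map_poly intr (rmodp f (Phi p)) = 0 :> {poly 'F_N} by rewrite coef0.
apply: (poly_eq0_at_roots p_prime zP) => [|s s0].
  exact: leq_trans (size_poly _ _) (rmodp_Phi_size f).
by rewrite horner_rmodp_Phi // f0.
Qed.

(** By [rmodp_Phi_dvd] the divisions by N defining [u] are exact, so f(zeta) / N lies in Z[zeta].
    All its conjugates have absolute value 1, and [integral_unit_monomial] applies. *)
Lemma multiple_of_N_monomial (f : {poly int}) :
    (forall s : 'F_p, s != 0 -> (map_poly intr f).[z ^+ s] = 0) ->
    (forall s : 'F_p, s != 0 ->
      (map_poly intr f).[zeta ^+ s] * (map_poly intr f).[zeta ^+ (- s)%R]
        = N%:R ^+ 2) ->
  exists (e : int) (k0 : 'F_p), e ^+ 2 = 1 /\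
    forall s : 'F_p, s != 0 ->
      (map_poly intr f).[zeta ^+ s] = N%:R * (e%:~R * zeta ^+ (s * k0)%R).
Proof.
move=> fz fzeta; pose u (k : 'F_p) := ((rmodp f (Phi p))`_k %/ N%:Z)%Z.
have uE (s : 'F_p) : s != 0 -> (map_poly intr f).[zeta ^+ s] =
    N%:R * \sum_(k : 'F_p) (u k)%:~R * zeta ^+ (s * k)%R.
  move=> s0; rewrite -horner_rmodp_Phi // (@horner_coef_wide _ p); last first.
    rewrite size_map_inj_poly ?rmorph0 //; last exact: intr_inj.
    exact: leq_trans (rmodp_Phi_size f) (leq_pred p).
  rewrite -(big_Fp p_prime (fun k => _`_k * (zeta ^+ s) ^+ k)) mulr_sumr.
  apply: eq_bigr => k _; rewrite coef_map /= mulrA expr_FpM ?(prim_expr_order zetaP) //.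
  by congr (_ * _); rewrite -[N%:R]/(N%:Z%:~R) -rmorphM /= mulrC divzK ?rmodp_Phi_dvd.
have N0 : N%:R != 0 :> algC by rewrite pnatr_eq0 -lt0n prime_gt0.
have [s s0|e [k0 [e1 uk]]] := @integral_unit_monomial p p_prime zeta zetaP u.
  apply: (mulfI (expf_neq0 2 N0)); rewrite mulr1 -[RHS](fzeta s s0).
  by rewrite !uE ?oppr_eq0 // mulrACA.
by exists e, k0; split=> // s s0; rewrite uE // uk.
Qed.

(** Here h is the complex conjugate of g, and f h is divisible by N = g h with f h / N = f / g of
    absolute value 1. The conclusion is an identity in Z[X], not of complex values, so that it can
    later be evaluated at z modulo N and at 1 modulo p. *)
Lemma norm_N_associate (f g h : {poly int}) :
    (forall s : 'F_p, s != 0 ->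
      (map_poly intr f).[zeta ^+ s] * (map_poly intr f).[zeta ^+ (- s)%R]
        = N%:R) ->
    (forall s : 'F_p, s != 0 ->
      (map_poly intr g).[zeta ^+ s] * (map_poly intr h).[zeta ^+ s] = N%:R) ->
    (forall s : 'F_p, s != 0 ->
      (map_poly intr h).[zeta ^+ (- s)%R] = (map_poly intr g).[zeta ^+ s]) ->
    (forall s : 'F_p, s != 0 -> (map_poly intr (f * h)).[z ^+ s] = 0) ->
  exists (e : int) (k0 : 'F_p) (r : {poly int}), e ^+ 2 = 1 /\
    f = e%:P * 'X^k0 * g + r * Phi p.
Proof.
move=> ff gh hg fhz.
have [//|s s0|e [k0 [e1 fhE]]] := multiple_of_N_monomial (f := f * h).
  rewrite rmorphM /= !hornerM mulrACA ff // hg // [X in _ * X]mulrC.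
  by rewrite gh // expr2.
exists e, k0, (rdivp (f - e%:P * 'X^k0 * g) (Phi p)); split=> //.
rewrite -(dvdp_Phi zetaP) ?subrKC // => s s0.
have N0 : N%:R != 0 :> algC by rewrite pnatr_eq0 -lt0n prime_gt0.
rewrite rmorphB !rmorphM /= hornerD hornerN !hornerM map_polyXn hornerXn.
rewrite map_polyC hornerC /=.
have h0 : (map_poly intr h).[zeta ^+ s] != 0.
  by apply: contraNneq N0 => h0; rewrite -(gh s s0) h0 mulr0.
apply: (mulIf h0); rewrite mul0r mulrBl -(mulrA (_ * _)) gh //.
move: (fhE s s0); rewrite rmorphM hornerM => ->.
by rewrite expr_FpM ?(prim_expr_order zetaP) // mulrC subrr.
Qed.

End NormNElements.

End ModPhi.

(** * Jacobi sums *)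

Section Characters.

Variables (F : finFieldType) (K : fieldType).

(** The value at 0 is left free; character sums always exclude it. *)
Definition is_mult_char (chi : F -> K) :=
  (forall x, x != 0 -> chi x != 0) /\
  (forall x y, x != 0 -> y != 0 -> chi (x * y) = chi x * chi y).

Lemma mult_char1 (chi : F -> K) : is_mult_char chi -> chi 1 = 1.
Proof.
move=> [chi0 chiM]; apply: (mulfI (chi0 1 (oner_neq0 _))).
by rewrite -chiM ?oner_neq0 // !mulr1.
Qed.

Lemma mult_char_div (chi : F -> K) (x y : F) :
  is_mult_char chi -> x != 0 -> y != 0 -> chi (x / y) = chi x / chi y.
Proof.
move=> [chi0 chiM] x0 y0; apply: (mulIf (chi0 y y0)).
by rewrite divfK ?chi0 // -chiM ?mulf_neq0 ?invr_eq0 // divfK.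
Qed.

Lemma sum_mult_char (chi : F -> K) (c : F) :
  is_mult_char chi -> c != 0 -> chi c != 1 -> \sum_(x | x != 0) chi x = 0.
Proof.
move=> [_ chiM] c0 chic; apply/eqP.
have : chi c * (\sum_(x | x != 0) chi x) = \sum_(x | x != 0) chi x.
  rewrite [RHS](reindex_inj (mulfI c0)) mulr_sumr /=.
  by apply: eq_big => [x|x x0]; rewrite ?mulf_eq0 ?negb_or ?c0 // chiM.
move/eqP; rewrite -subr_eq0 -[X in _ - X]mul1r -mulrBl mulf_eq0 subr_eq0.
by rewrite (negPf chic).
Qed.

(* The pairs x <> y are parametrised by the ratios r = x / y and
   s = (1 - x) / (1 - y), which turns the double sum into a product. *)
Lemma jacobi_sum_norm (chi1 chi2 : F -> K) :
    is_mult_char chi1 -> is_mult_char chi2 ->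
    \sum_(x | x != 0) chi1 x = 0 -> \sum_(x | x != 0) chi2 x = 0 ->
    \sum_(x | x != 0) chi1 x * chi2 x = 0 ->
  (\sum_(x | (x != 0) && (x != 1)) chi1 x * chi2 (1 - x)) *
  (\sum_(x | (x != 0) && (x != 1)) (chi1 x)^-1 * (chi2 (1 - x))^-1)
  = #|F|%:R.
Proof.
move=> chi1P chi2P sum1 sum2 sum12.
pose ok := [pred x : F | (x != 0) && (x != 1)].
have sum_ok (f : F -> K) : \sum_(x | x != 0) f x = 0 -> f 1 = 1 ->
    \sum_(x | ok x) f x = -1.
  rewrite (bigD1 1) ?oner_neq0 //= => /eqP; rewrite addrC addr_eq0 => /eqP -> ->.
  by [].
have okC x : ok x -> 1 - x != 0 by case/andP=> _; rewrite subr_eq0 eq_sym.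
have offdiag (f : F -> F -> K) : \sum_(x | ok x) \sum_(y | ok y) f x y =
    \sum_(x | ok x) f x x + \sum_(x | ok x) \sum_(y | ok y && (y != x)) f x y.
  by rewrite -big_split /=; apply: eq_bigr => x okx; rewrite (bigD1 x).
have card_ok : \sum_(x | ok x) (1 : K) = #|F|%:R - 2.
  have -> : #|F|%:R = \sum_(x : F) (1 : K) by rewrite sumr_const.
  rewrite [X in _ = X - _](bigD1 0) //= [X in _ = _ + X - _](bigD1 1) ?oner_neq0 //=.
  by rewrite addrA [1 + 1 + _]addrC addrK.
(* The full sum over r and s is (-1)(-1) = 1 and its diagonal is -1, so the part r != s equals 2. In
   the original product the diagonal x = y contributes #|F| - 2. *)
have offprod := offdiag (fun r s => chi1 r * chi2 s).
rewrite -big_distrlr /= (sum_ok chi1) ?mult_char1 // in offprod.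
rewrite (sum_ok chi2) ?mult_char1 // in offprod.
rewrite (sum_ok (fun x => chi1 x * chi2 x)) ?mult_char1 ?mulr1 // in offprod.
rewrite big_distrlr /= offdiag (eq_bigr (fun=> 1)); last first.
  move=> x okx; have [chi10 chi20] := (chi1P.1, chi2P.1).
  have /andP[x0 _] := okx.
  by rewrite mulrACA !divff ?mulr1 ?chi10 ?chi20 ?okC.
rewrite mulrNN mulr1 in offprod.
rewrite card_ok; suff -> : \sum_(x | ok x) \sum_(y | ok y && (y != x))
    chi1 x * chi2 (1 - x) * ((chi1 y)^-1 * (chi2 (1 - y))^-1)
  = \sum_(x | ok x) \sum_(y | ok y && (y != x)) chi1 x * chi2 y.
  by apply: (addrI (-1)); rewrite addrCA -offprod; ring.
rewrite !pair_big_dep /=.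
(* [h] solves x = r y and 1 - x = s (1 - y), that is y = (1 - s) / (r - s); [h'] sends (x, y) to (r,
   s). *)
pose h (q : F * F) := (q.1 * (1 - q.2) / (q.1 - q.2), (1 - q.2) / (q.1 - q.2)).
pose h' (q : F * F) := (q.1 / q.2, (1 - q.1) / (1 - q.2)).
rewrite [RHS](reindex_onto h' h) /=; last first.
  case=> r s /= /andP[/andP[r0 r1] /andP[/andP[s0 s1] sr]].
  rewrite /h /h' /=; congr (_, _); field.
    by rewrite (subr_eq0 r s) (subr_eq0 1 s) ![_ == s]eq_sym s1 sr.
  have -> : r - s - (1 - s) = r - 1 by ring.
  by rewrite (subr_eq0 r s) (subr_eq0 r 1) [_ == s]eq_sym r1 sr.
apply: eq_big => [[x y]|[x y]] /=.
  apply/idP/idP.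
    move=> /andP[okx /andP[oky yx]].
    have [/andP[x0 x1] /andP[y0 y1]] := (okx, oky).
    have rs : x / y - (1 - x) / (1 - y) = (x - y) / (y * (1 - y)).
      by field; rewrite y0 okC.
    have div1 (u v : F) : v != 0 -> (u / v == 1) = (u == v).
      by move=> v0; rewrite -subr_eq0 -[X in _ - X](divff v0) -mulrBl
         mulf_eq0 invr_eq0 (negPf v0) orbF subr_eq0.
    rewrite !mulf_neq0 ?invr_eq0 ?okC //= !div1 ?okC //.
    have xy : x - y != 0 by rewrite subr_eq0 eq_sym.
    have yC := okC y oky.
    rewrite [x == y]eq_sym yx (inj_eq (addrI 1)) eqr_opp [x == y]eq_sym yx /=.
    rewrite [_ == x / y]eq_sym -subr_eq0 rs !mulf_neq0 ?invr_eq0 ?mulf_neq0 //=.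
    have Ey : (1 - (1 - x) / (1 - y)) = (x - y) / (1 - y) by field.
    apply/eqP; rewrite /h /h' /= rs Ey; congr (_, _).
      by field; rewrite y0 yC xy.
    by field; rewrite y0 yC xy.
  case/andP => /andP[/andP[r0 r1] /andP[/andP[s0 _] _]] _.
  move: r0 s0; rewrite !mulf_eq0 !invr_eq0 !negb_or => /andP[x0 y0] /andP[x1 y1].
  rewrite x0 y0 ![_ == 1]eq_sym -!(subr_eq0 1) x1 y1 /=.
  by apply: contraNneq r1 => ->; rewrite divff.
move=> /andP[okx /andP[oky _]].
have [/andP[x0 _] /andP[y0 _]] := (okx, oky).
by rewrite !mult_char_div ?okC // mulrACA.
Qed.

End Characters.

(** * Power sums over F_N *)

Section PowerSums.

Variables (N : nat) (N_prime : prime N).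

(** Otherwise X^e - 1 would have more roots than its degree. *)
Lemma exists_expr_neq1 (F : finFieldType) (e : nat) :
  (0 < e < #|F|.-1)%N -> exists2 c : F, c != 0 & c ^+ e != 1.
Proof.
case/andP=> e_gt0 e_lt.
have [/existsP[c /andP[]]|/existsPn h] :=
  boolP [exists c : F, (c != 0) && (c ^+ e != 1)].
  by exists c.
have /eqP : 'X^e - 1 = 0 :> {poly F}.
  apply: (@roots_geq_poly_eq0 _ _ (enum (predC1 (0 : F)))).
  - apply/allP => x; rewrite mem_enum inE => x0; rewrite rootE !hornerE subr_eq0.
    by move: (h x); rewrite x0 negbK.
  - exact: enum_uniq.
  by rewrite size_XnsubC // -cardE cardC1.
by rewrite -size_poly_eq0 size_XnsubC.
Qed.

Lemma sum_expr_Fp_small (e : nat) :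
  (0 < e < N.-1)%N -> \sum_(x : 'F_N) x ^+ e = 0.
Proof.
move=> /andP[e0 eN]; have [|c c0 ce] := @exists_expr_neq1 'F_N e.
  by rewrite card_Fp // e0.
rewrite (bigD1 0) //= expr0n gtn_eqF // add0r.
apply: (sum_mult_char (K := 'F_N) (chi := fun x => x ^+ e) _ c0 ce).
by split=> [x x0|x y _ _]; rewrite ?expf_neq0 ?exprMn.
Qed.

Lemma expr_Fp_pred (x : 'F_N) : x != 0 -> x ^+ N.-1 = 1.
Proof.
move=> x0; apply: (mulfI x0); rewrite mulr1 -exprS prednK ?prime_gt0 //.
by rewrite -{2}(expf_card x) card_Fp.
Qed.

(** In this range N - 1 is the only exponent divisible by N - 1; its sum counts the N - 1 nonzero
    elements. *)
Lemma sum_expr_Fp_lt (e : nat) :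
  (0 < e < (N.-1).*2)%N -> \sum_(x : 'F_N) x ^+ e = - (e == N.-1)%:R.
Proof.
case/andP=> e0 eN.
have N1 : (0 < N.-1)%N by rewrite -ltnS prednK ?prime_gt0 ?prime_gt1.
have [eltN|eltN|->] := ltngtP e N.-1.
- by rewrite sum_expr_Fp_small ?e0 ?oppr0.
- rewrite oppr0 -[RHS](@sum_expr_Fp_small (e - N.-1)); last by lia.
  apply: eq_bigr => x _; have [->|x0] := eqVneq x 0.
    by rewrite !expr0n !gtn_eqF ?subn_gt0.
  by rewrite -[in LHS](subnKC (ltnW eltN)) exprD expr_Fp_pred // mul1r.
rewrite (bigD1 0) //= expr0n gtn_eqF // add0r (eq_bigr (fun=> 1)).
  rewrite sumr_const cardC1 card_Fp // -subn1 natrB ?prime_gt0 //.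
  by rewrite (natr_p N_prime) sub0r.
by move=> x x0; rewrite expr_Fp_pred.
Qed.

(** Expanding (1 - x)^B, only the term with A + i = N - 1 survives. If N - 1 - A > B there is no
    such term, in agreement with the binomial coefficient being 0. *)
Lemma sum_expr_mul_Fp (A B : nat) :
    (0 < A <= N.-1)%N -> (A + B < (N.-1).*2)%N ->
  \sum_(x : 'F_N) x ^+ A * (1 - x) ^+ B
    = - ((-1) ^+ (N.-1 - A) * 'C(B, N.-1 - A)%:R).
Proof.
case/andP=> A0 AN AB.
transitivity (\sum_(i < B.+1) (-1) ^+ i * 'C(B, i)%:R *
                (- (i == N.-1 - A :> nat)%N%:R) : 'F_N).
  under eq_bigr => x _ do rewrite exprBn mulr_sumr.
  rewrite exchange_big /=; apply: eq_bigr => i _.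
  have -> : (i == N.-1 - A :> nat)%N = (A + i == N.-1)%N by apply/eqP/eqP; lia.
  rewrite -sum_expr_Fp_lt ?mulr_sumr; last by have := ltn_ord i; lia.
  by apply: eq_bigr => x _; rewrite expr1n mulr1 -mulr_natr exprD; ring.
have [NB|NB] := leqP (N.-1 - A) B.
  have i0P : (N.-1 - A < B.+1)%N by [].
  rewrite (bigD1 (Ordinal i0P)) //= eqxx mulrN1 big1 ?addr0 // => i ii.
  have -> : (i == N.-1 - A :> nat)%N = false.
    by apply: contraNF ii => /eqP ii; apply/eqP/val_inj.
  by rewrite oppr0 mulr0.
rewrite bin_small // mulr0 oppr0 big1 // => i _.
by rewrite ltn_eqF ?oppr0 ?mulr0 //; have := ltn_ord i; lia.
Qed.

End PowerSums.

(** * The Jacobi sums J_j: absolute values and reductions modulo N *)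

Section JacobiSums.

Variables (p N n : nat) (p_prime : prime p) (N_prime : prime N).
Hypotheses (p_gt2 : (2 < p)%N) (N_eq : N.-1 = (p * n)%N).
Variables (z : 'F_N) (zeta : algC).
Hypotheses (zP : p.-primitive_root z) (zetaP : p.-primitive_root zeta).

Let zp : z ^+ p = 1 := prim_expr_order zP.
Let zetap : zeta ^+ p = 1 := prim_expr_order zetaP.

Lemma zeta_neq0 : zeta != 0.
Proof.
apply: contra_eq_neq zetap => ->.
by rewrite expr0n gtn_eqF ?prime_gt0 // eq_sym oner_neq0.
Qed.

Lemma n_gt0 : (0 < n)%N.
Proof. by rewrite lt0n; apply: contraTneq (prime_gt1 N_prime) => n0; lia. Qed.

(** The exponent of the p-th power residue symbol x^n in base z. The default 0 is taken at x = 0. *)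
Definition ind (x : 'F_N) : 'F_p :=
  odflt 0 [pick k : 'F_p | z ^+ k == x ^+ n].

Lemma indE (x : 'F_N) : x != 0 -> z ^+ ind x = x ^+ n.
Proof.
move=> x0; rewrite /ind; case: pickP => [k /eqP //|h].
have xnp : (x ^+ n) ^+ p = 1 by rewrite -exprM mulnC -N_eq expr_Fp_pred.
have [i xi] := prim_rootP zP xnp.
by have := h (i%:R : 'F_p); rewrite expr_Fp_nat // xi eqxx.
Qed.

Lemma indM (x y : 'F_N) : x != 0 -> y != 0 -> ind (x * y) = ind x + ind y.
Proof.
move=> x0 y0; apply: (expr_Fp_inj p_prime zP).
by rewrite /= expr_FpD // !indE ?mulf_neq0 // exprMn.
Qed.

Lemma ind1 : ind 1 = 0.
Proof. by apply: (addrI (ind 1)); rewrite -indM ?oner_neq0 // mulr1 addr0. Qed.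

Lemma ind_nontrivial : exists2 c : 'F_N, c != 0 & ind c != 0.
Proof.
have [|c c0 cn] := @exists_expr_neq1 'F_N n.
  by rewrite card_Fp // N_eq n_gt0 /= ltn_Pmull ?n_gt0 // prime_gt1.
by exists c => //; apply: contraNneq cn => i0; rewrite -indE // i0 expr0.
Qed.

Lemma natr_Fp_neq0_2 : 2%:R != 0 :> 'F_p.
Proof. by rewrite natr_Fp_eq0 // dvdn_prime2 // gtn_eqF. Qed.

Lemma Fp_double_eq0 (x : 'F_p) : x + x = 0 -> x = 0.
Proof.
move/eqP; rewrite -mulr2n -mulr_natr mulf_eq0 (negPf natr_Fp_neq0_2) orbF.
by move/eqP.
Qed.

(** The terms at x and 1/x are opposite, and p is odd. This makes the derivative of [jacobi] at 1
    vanish modulo p. *)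
Lemma sum_ind : \sum_(x | (x != 0) && (x != 1)) ind x = 0.
Proof.
have -> : \sum_(x | (x != 0) && (x != 1)) ind x = \sum_(x | x != 0) ind x.
  by rewrite [RHS](bigD1 1) ?oner_neq0 //= ind1 add0r.
have inv : \sum_(x : 'F_N | x != 0) ind x = \sum_(x : 'F_N | x != 0) ind x^-1.
  by rewrite (reindex_inj (@invr_inj _)); apply: eq_bigl => x; rewrite invr_eq0.
apply: Fp_double_eq0; rewrite {2}inv -big_split big1 //= => x x0.
by rewrite -indM ?invr_eq0 // mulfV // ind1.
Qed.

Definition ind_char (c : 'F_p) (x : 'F_N) : algC := zeta ^+ (c * ind x)%R.

Lemma ind_charP (c : 'F_p) : is_mult_char (ind_char c).
Proof.
split=> [x _|x y x0 y0]; last by rewrite /ind_char indM // mulrDr expr_FpD.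
by rewrite expf_neq0 // zeta_neq0.
Qed.

Lemma sum_ind_char (c : 'F_p) : c != 0 -> \sum_(x | x != 0) ind_char c x = 0.
Proof.
move=> c0; have [y y0 iy] := ind_nontrivial.
apply: (sum_mult_char (ind_charP c) y0); rewrite /ind_char.
apply: contra_neq (mulf_neq0 c0 iy) => h.
by apply: (expr_Fp_inj p_prime zetaP); rewrite /= h expr0.
Qed.

Variable j : 'F_p.
Hypotheses (j0 : j != 0) (j1 : j != 1).

(** J_j as an integer polynomial with exponents in [0, p): its conjugates are the values at zeta^s,
    its reductions above N the values at z^s, and its expansion modulo (1 - zeta)^2 is read off at 1
    modulo p. *)
Definition jacobi : {poly int} :=
  \sum_(x : 'F_N | (x != 0) && (x != 1)) 'X^((j * ind (1 - x) - ind x)%R : 'F_p).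

Lemma horner_jacobi (R : comNzRingType) (x : R) :
  (map_poly intr jacobi).[x]
    = \sum_(y : 'F_N | (y != 0) && (y != 1)) x ^+ (j * ind (1 - y) - ind y)%R.
Proof.
rewrite rmorph_sum horner_sum; apply: eq_bigr => y _ /=.
by rewrite map_polyXn hornerXn.
Qed.

(** The characters involved have exponents -s, s j and s (j - 1); all are nontrivial because j is
    neither 0 nor 1. *)
Lemma jacobi_norm (s : 'F_p) : s != 0 ->
  (map_poly intr jacobi).[zeta ^+ s] * (map_poly intr jacobi).[zeta ^+ (- s)%R]
    = N%:R.
Proof.
move=> s0; have sj0 : s * j != 0 by rewrite mulf_neq0.
rewrite -{1}(card_Fp N_prime) -(jacobi_sum_norm (ind_charP (- s)) (ind_charP (s * j))).
- rewrite !horner_jacobi /ind_char; congr (_ * _); apply: eq_bigr => y _.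
    by rewrite -!expr_FpM // -expr_FpD //; congr (_ ^+ nat_of_ord _); ring.
  rewrite -invfM -expr_FpD // -expr_FpN // -expr_FpM //.
  by congr (_ ^+ nat_of_ord _); ring.
- by rewrite sum_ind_char ?oppr_eq0.
- by rewrite sum_ind_char.
- rewrite -[RHS](@sum_ind_char (s * (j - 1))) ?mulf_neq0 ?subr_eq0 //.
  apply: eq_bigr => y _; rewrite /ind_char -expr_FpD //.
  by congr (_ ^+ nat_of_ord _); ring.
Qed.

(** Since z^(ind x) = x^n, the Jacobi sum becomes a power sum. Both exponents are positive, so x = 0
    and x = 1 may be included. *)
Lemma horner_jacobi_modN (s : 'F_p) : s != 0 ->
  (map_poly intr jacobi).[z ^+ s]
    = \sum_(x : 'F_N) x ^+ (n * (p - s)) * (1 - x) ^+ (n * (j * s)%R).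
Proof.
move=> s0; rewrite horner_jacobi -val_FpN //.
have e0 (k : 'F_p) : k != 0 -> (n * k)%N != 0%N.
  by move=> k0; rewrite -lt0n muln_gt0 n_gt0 lt0n.
rewrite [RHS](bigD1 0) //= [X in _ = _ + X](bigD1 1) ?oner_neq0 //=.
rewrite subrr !expr0n (negPf (e0 _ _)) ?oppr_eq0 // (negPf (e0 _ _)) ?mulf_neq0 //.
rewrite mul0r mulr0 !add0r; apply: eq_bigr => x /andP[x0 x1].
have x1' : 1 - x != 0 by rewrite subr_eq0 eq_sym.
rewrite !exprM -!indE // -!expr_FpM // -expr_FpD //.
by congr (_ ^+ nat_of_ord _); ring.
Qed.

(** The binomial coefficient of [sum_expr_mul_Fp] is here 'C(n <j s>, n <s>), which is 0 when <j s>
    < <s>. *)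
Lemma jacobi_modN_eq0 (s : 'F_p) :
  s != 0 -> ((j * s)%R < s)%N -> (map_poly intr jacobi).[z ^+ s] = 0.
Proof.
move=> s0 js; have [sp n0] := (ltn_Fp p_prime s, n_gt0).
have s_gt0 : (0 < s)%N by rewrite lt0n.
have le1 : (n * (p - s) <= N.-1)%N by rewrite N_eq mulnC leq_mul2r leq_subr orbT.
have E : (N.-1 - n * (p - s) = n * s)%N.
  by rewrite N_eq mulnC -mulnBr subKn // ltnW.
rewrite horner_jacobi_modN // sum_expr_mul_Fp //.
- by rewrite E bin_small ?mulr0 ?oppr0 // ltn_pmul2l.
- by rewrite le1 muln_gt0 n0 subn_gt0 sp.
- rewrite -mulnDr N_eq -mul2n mulnA [X in (X < _)%N]mulnC ltn_pmul2r //; lia.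
Qed.

Lemma n_even : ~~ odd n.
Proof.
have n0 := n_gt0.
have N_odd : odd N by case: (even_prime N_prime) => // N2; nia.
have p_odd : odd p by case: (even_prime p_prime) => // p2; lia.
apply/negP => n_odd; have : odd N.-1.+1 by rewrite prednK ?prime_gt0.
by rewrite /= N_eq oddM p_odd n_odd.
Qed.

Lemma jacobi_modN_1 : (map_poly intr jacobi).[z] = - 'C(n * j, n)%:R.
Proof.
have [jp n0] := (ltn_Fp p_prime j, n_gt0).
have := @horner_jacobi_modN 1 (oner_neq0 _); rewrite val_Fp1 // expr1 mulr1 => ->.
have E : (N.-1 - n * (p - 1) = n)%N.
  by rewrite N_eq mulnC -mulnBr subKn ?muln1 // prime_gt0.
rewrite sum_expr_mul_Fp //.
- by rewrite E -signr_odd (negPf n_even) mul1r.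
- rewrite muln_gt0 n0 subn_gt0 prime_gt1 //= N_eq [X in (_ <= X)%N]mulnC.
  by rewrite leq_mul2l leq_subr orbT.
- rewrite -mulnDr N_eq -mul2n mulnA [X in (X < _)%N]mulnC ltn_pmul2r //; lia.
Qed.

(** * Comparison of J_j with a product of conjugates of a + b zeta *)

Variables (a b : int).
Hypotheses (az : a%:~R + b%:~R * z = 0) (b_neq0 : b%:~R != 0 :> 'F_N).
Hypothesis ab_neq0 : (a + b)%:~R != 0 :> 'F_p.
Hypothesis normN :
  \prod_(k : 'F_p | k != 0) (a%:~R + b%:~R * zeta ^+ k) = N%:R :> algC.

(** This is the condition of [jacobi_modN_eq0] at s = 1/k; the factor a + b X^k vanishes at z^s
    exactly when k s = 1. *)
Definition half_system (k : 'F_p) : bool := ((j / k)%R < (k^-1)%R)%N.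

Definition half_prod (h : pred 'F_p) : {poly int} :=
  \prod_(k : 'F_p | (k != 0) && h k) (a%:P + b%:P * 'X^k).

(** Negation replaces <u> by p - <u> and reverses the inequality; equality is excluded by j != 1. *)
Lemma halfN (k : 'F_p) : k != 0 -> half_system (- k) = ~~ half_system k.
Proof.
move=> k0; rewrite /half_system invrN mulrN !val_FpN ?mulf_neq0 ?invr_eq0 //.
have [jk kk] := (ltn_Fp p_prime (j / k), ltn_Fp p_prime k^-1).
have : nat_of_ord (j / k) != nat_of_ord k^-1.
  apply: contra_neq j1 => /val_inj jk1.
  by rewrite -(divfK k0 j) jk1 mulVf.
by move: (nat_of_ord _) (nat_of_ord _) jk kk => u v; lia.
Qed.

(** The factor k = 1 is the one that vanishes at z, so Q_j does not vanish there and its logarithm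
    can be taken. *)
Lemma half1 : ~~ half_system 1.
Proof.
rewrite /half_system invr1 mulr1 -leqNgt.
by rewrite val_Fp1 // lt0n.
Qed.

Lemma horner_half_prod (R : comNzRingType) (h : pred 'F_p) (x : R) :
  (map_poly intr (half_prod h)).[x]
    = \prod_(k : 'F_p | (k != 0) && h k) (a%:~R + b%:~R * x ^+ k).
Proof.
rewrite rmorph_prod horner_prod; apply: eq_bigr => k _ /=.
by rewrite rmorphD rmorphM /= !map_polyC map_polyXn hornerD hornerM hornerXn !hornerC.
Qed.

Lemma half_prod_norm (s : 'F_p) : s != 0 ->
  (map_poly intr (half_prod half_system)).[zeta ^+ s] *
  (map_poly intr (half_prod (predC half_system))).[zeta ^+ s] = N%:R.
Proof.
move=> s0; rewrite !horner_half_prod -bigID /= -normN.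
rewrite [RHS](reindex_inj (mulfI s0)); apply: eq_big => [k|k _] /=.
  by rewrite mulf_eq0 (negPf s0).
by rewrite expr_FpM.
Qed.

Lemma half_prod_conj (s : 'F_p) :
  (map_poly intr (half_prod (predC half_system))).[zeta ^+ (- s)%R]
    = (map_poly intr (half_prod half_system)).[zeta ^+ s].
Proof.
rewrite !horner_half_prod (reindex_inj oppr_inj) /=; apply: eq_big => [k|k _].
  by rewrite oppr_eq0; case: eqVneq => //= k0; rewrite halfN // negbK.
by rewrite -!expr_FpM // mulrNN.
Qed.

(** Either J_j vanishes at z^s, or k = 1/s lies in the complementary half and its factor is a + b z
    = 0. *)
Lemma jacobi_half_prod_modN (s : 'F_p) : s != 0 ->
  (map_poly intr (jacobi * half_prod (predC half_system))).[z ^+ s] = 0.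
Proof.
move=> s0; rewrite rmorphM hornerM horner_half_prod.
have [js|js] := boolP ((j * s)%R < s)%N.
  by rewrite jacobi_modN_eq0 // mul0r.
rewrite (bigD1 s^-1) /= ?invr_eq0 ?s0 /half_system ?invrK //.
by rewrite -expr_FpM // divff // expr1 az mul0r mulr0.
Qed.

Lemma jacobi_half_prod : exists (e : int) (k0 : 'F_p) (r : {poly int}),
  e ^+ 2 = 1 /\ jacobi = e%:P * 'X^k0 * half_prod half_system + r * Phi p.
Proof.
apply: (norm_N_associate p_prime N_prime zetaP zP).
- exact: jacobi_norm.
- exact: half_prod_norm.
- by move=> s _; exact: half_prod_conj.
- exact: jacobi_half_prod_modN.
Qed.
(** There are N - 2 terms, and N = 1 modulo p. *)
Lemma jacobi_at_1 : (map_poly intr jacobi).[1] = -1 :> 'F_p.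
Proof.
rewrite horner_jacobi; under eq_bigr do rewrite expr1n.
have card : N%:R = \sum_(x : 'F_N) 1 :> 'F_p by rewrite sumr_const card_Fp.
have N1 : N%:R = 1 :> 'F_p.
  have -> : N = (1 + p * n)%N by rewrite -N_eq add1n prednK ?prime_gt0.
  by rewrite natrD natrM (natr_p p_prime) mul0r addr0.
move: card; rewrite N1 (bigD1 0) //= (bigD1 1) ?oner_neq0 //=.
rewrite -[X in X = _]addr0 => /addrI /esym/eqP.
by rewrite addrC addr_eq0 => /eqP.
Qed.

Lemma deriv_jacobi_at_1 : (map_poly intr jacobi)^`().[1] = 0 :> 'F_p.
Proof.
rewrite rmorph_sum [deriv _]linear_sum horner_sum.
transitivity (\sum_(x : 'F_N | (x != 0) && (x != 1)) (j * ind (1 - x) - ind x)).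
  apply: eq_bigr => x _ /=.
  by rewrite map_polyXn derivXn hornerMn hornerXn expr1n natr_Fp.
rewrite sumrB -mulr_sumr sum_ind subr0 -[RHS](mulr0 j) -[in RHS]sum_ind.
congr (_ * _); rewrite [RHS](reindex_inj (can_inj (subKr 1))).
apply: eq_bigl => x; rewrite subr_eq0 [1 == x]eq_sym andbC; congr (~~ _ && _).
by rewrite subr_eq addrC -subr_eq subrr eq_sym.
Qed.

Lemma Phi_at_1 : (map_poly intr (Phi p)).[1] = 0 :> 'F_p.
Proof.
rewrite horner_Phi; under eq_bigr do rewrite expr1n.
by rewrite sumr_const card_ord (natr_p p_prime).
Qed.

Lemma sum_Fp_id : \sum_(k : 'F_p) k = 0.
Proof.
apply: Fp_double_eq0; rewrite {2}(reindex_inj oppr_inj) -big_split big1 //.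
by move=> k _; rewrite /= subrr.
Qed.

Lemma deriv_Phi_at_1 : (map_poly intr (Phi p))^`().[1] = 0 :> 'F_p.
Proof.
rewrite /Phi poly_def rmorph_sum [deriv _]linear_sum horner_sum -[RHS]sum_Fp_id.
rewrite -[RHS](eq_bigr _ (fun k _ => natr_Fp k)) (big_Fp p_prime (fun k => k%:R)).
apply: eq_bigr => i _ /=.
by rewrite scale1r map_polyXn derivXn hornerMn hornerXn expr1n.
Qed.

(** Logarithmic derivative at 1: the factor a + b X^k contributes k b / (a + b), with denominators
    cleared. *)
Lemma deriv_half_prod_at_1 (h : pred 'F_p) :
  (a + b)%:~R * (map_poly intr (half_prod h))^`().[1]
    = b%:~R * (\sum_(k | (k != 0) && h k) k) * (map_poly intr (half_prod h)).[1]
    :> 'F_p.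
Proof.
rewrite rmorph_prod.
apply: (big_rec2 (fun (f : {poly 'F_p}) (S : 'F_p) =>
   (a + b)%:~R * f^`().[1] = b%:~R * S * f.[1])).
  by rewrite derivC hornerC !mulr0 mul0r.
move=> k f S _ IH /=.
rewrite [map_poly _ _]rmorphD rmorphM /= !map_polyC map_polyXn derivM !hornerE mulrDr.
rewrite [X in _ + X = _]mulrCA IH derivD derivM !derivC derivXn !hornerE.
rewrite hornerMn hornerXn !expr1n natr_Fp rmorphD /=; ring.
Qed.

(* Compare derivatives at X = 1: modulo p, [Phi p] = (X - 1)^(p - 1) and its
   derivative both vanish there. *)
Lemma jacobi_exponent (e : int) (k0 : 'F_p) (r : {poly int}) :
    jacobi = e%:P * 'X^k0 * half_prod half_system + r * Phi p ->
  (a + b)%:~R * k0 + b%:~R * (\sum_(k | (k != 0) && half_system k) k) = 0 :> 'F_p.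
Proof.
move=> /(congr1 (map_poly (intr : int -> 'F_p))) E.
rewrite rmorphD !rmorphM /= map_polyC map_polyXn /= in E.
have E1 := congr1 (fun f => f.[1]) E.
have E2 := congr1 (fun f => f^`().[1]) E.
rewrite /= jacobi_at_1 !hornerE Phi_at_1 !expr1n !mulr1 mulr0 addr0 in E1.
rewrite /= deriv_jacobi_at_1 derivD !derivM derivXn derivC in E2.
rewrite !hornerE Phi_at_1 deriv_Phi_at_1 !expr1n hornerMn hornerXn expr1n natr_Fp in E2.
move: (deriv_half_prod_at_1 half_system) E1 E2.
set Q := _.[1]; set Q' := _.[1]; set S := \sum_(k | _) k => QQ' E1 E2.
rewrite /= !mulr0 !addr0 mulr1 in E2.
(* [E1] reads -1 = e Q and [E2] reads 0 = e k0 Q + e Q'; multiplying the goal by -1 = e Q reduces it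
   to (a + b) times [E2]. *)
apply/eqP; rewrite -oppr_eq0 -mulN1r E1 -mulrA mulrDr [Q' * (b%:~R * S)]mulrC -QQ'.
have -> : e%:~R * (Q' * ((a + b)%:~R * k0) + (a + b)%:~R * Q)
  = (a + b)%:~R * (e%:~R * k0 * Q' + e%:~R * Q) by ring.
by rewrite -E2 mulr0.
Qed.

(** * Logarithms of the binomial coefficients *)

Variable L : 'F_N -> 'F_p.
Hypothesis LM : forall x y, x != 0 -> y != 0 -> L (x * y) = L x + L y.

Lemma log1 : L 1 = 0.
Proof. by apply: (addrI (L 1)); rewrite -LM ?oner_neq0 // mulr1 addr0. Qed.

Lemma logN1 : L (-1) = 0.
Proof.
by apply: Fp_double_eq0; rewrite -LM ?oppr_eq0 ?oner_neq0 // mulrNN mulr1 log1.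
Qed.

Lemma logN (x : 'F_N) : x != 0 -> L (- x) = L x.
Proof. by move=> x0; rewrite -mulN1r LM ?oppr_eq0 ?oner_neq0 // logN1 add0r. Qed.

Lemma logX (x : 'F_N) (k : nat) : x != 0 -> L (x ^+ k) = k%:R * L x.
Proof.
move=> x0; elim: k => [|k IHk]; first by rewrite log1 mul0r.
by rewrite exprS LM ?expf_neq0 // IHk -natr1; ring.
Qed.

Lemma log_prod (I : Type) (s : seq I) (P : pred I) (f : I -> 'F_N) :
  (forall i, P i -> f i != 0) ->
  L (\prod_(i <- s | P i) f i) = \sum_(i <- s | P i) L (f i).
Proof.
move=> f0.
suff [] : L (\prod_(i <- s | P i) f i) = \sum_(i <- s | P i) L (f i) /\
          \prod_(i <- s | P i) f i != 0 by [].
apply: (big_rec2 (fun x y => L x = y /\ x != 0)).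
  by rewrite log1 oner_neq0.
move=> i x y Pi [Lx x0]; have fi := f0 i Pi.
by rewrite LM // Lx mulf_neq0.
Qed.

Lemma z_neq0 : z != 0.
Proof.
apply: contra_eq_neq zp => ->.
by rewrite expr0n gtn_eqF ?prime_gt0 // eq_sym oner_neq0.
Qed.

Lemma log_factor_neq0 (k : 'F_p) : k != 1 -> a%:~R + b%:~R * z ^+ k != 0.
Proof.
move=> k1; have -> : a%:~R + b%:~R * z ^+ k = b%:~R * (z ^+ k - z).
  by rewrite mulrBr addrC; congr (_ + _); apply/eqP; rewrite -addr_eq0 az.
rewrite mulf_neq0 // subr_eq0; apply: contra_neq k1 => zk.
apply: (expr_Fp_inj p_prime zP); rewrite /= zk.
by rewrite (expr_Fp_nat p_prime 1 zp) expr1.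
Qed.

(** Evaluate the identity of [jacobi_half_prod] at z, where [Phi p] vanishes, and apply [L]. Signs
    disappear because L(-1) = 0, and [jacobi_exponent] gives the exponent k0. *)
Lemma log_binomial :
  L 'C(n * j, n)%:R =
    \sum_(k : 'F_p | (k != 0) && half_system k)
      (L (a%:~R + b%:~R * z ^+ k) - b%:~R / (a + b)%:~R * k * L z).
Proof.
have [e [k0 [r [e1 E]]]] := jacobi_half_prod.
have k0E : k0 = - (b%:~R / (a + b)%:~R * \sum_(k | (k != 0) && half_system k) k).
  apply: (mulfI ab_neq0); have/eqP := jacobi_exponent E.
  by rewrite addr_eq0 => /eqP ->; rewrite mulrN mulrA [_ * (_ / _)]mulrC divfK.
have fac0 (k : 'F_p) : (k != 0) && half_system k -> a%:~R + b%:~R * z ^+ k != 0.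
  case/andP=> _ hk; apply: log_factor_neq0.
  by apply: contraTneq hk => ->; exact: half1.
rewrite sumrB -log_prod // -mulr_suml -mulr_sumr -mulNr -k0E.
have := congr1 (fun f => (map_poly intr f).[z]) E.
rewrite /= jacobi_modN_1 rmorphD !rmorphM /= map_polyC map_polyXn !hornerE.
have -> : (map_poly intr (Phi p)).[z] = 0.
  by have := horner_Phi_eq0 p_prime zP (oner_neq0 _); rewrite (expr_Fp_nat p_prime 1 zp).
rewrite mulr0 addr0 horner_half_prod => Ez.
have P0 : \prod_(k : 'F_p | (k != 0) && half_system k) (a%:~R + b%:~R * z ^+ k) != 0.
  exact/prodf_neq0.
have Q0 : z ^+ k0 *
    \prod_(k : 'F_p | (k != 0) && half_system k) (a%:~R + b%:~R * z ^+ k) != 0.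
  by rewrite mulf_neq0 ?expf_neq0 ?z_neq0.
transitivity (L (z ^+ k0 * \prod_(k : 'F_p | (k != 0) && half_system k)
                 (a%:~R + b%:~R * z ^+ k))); last first.
  by rewrite LM ?expf_neq0 ?z_neq0 // logX ?z_neq0 // natr_Fp addrC.
have {}Ez : 'C(n * j, n)%:R = - (e%:~R * (z ^+ k0 *
    \prod_(k : 'F_p | (k != 0) && half_system k) (a%:~R + b%:~R * z ^+ k))).
  by apply: oppr_inj; rewrite opprK mulrA; exact: Ez.
have [e_eq|e_eq] : e = 1 \/ e = -1 by move: e1; rewrite expr2; nia.
  by rewrite Ez e_eq mul1r logN.
by rewrite Ez e_eq mulN1r opprK.
Qed.
End JacobiSums.

Lemma sum_Fp_interval (p : nat) (V : nmodType) (f : nat -> V) (c : 'F_p) :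
    prime p ->
  \sum_(r : 'F_p | (r != 0) && (r < c)%N) f r = \sum_(1 <= r < c) f r.
Proof.
move=> p_prime; rewrite big_mkcond /=.
rewrite (eq_bigr (fun r : 'F_p => if (0 < r < c)%N then f r else 0)).
  rewrite (big_Fp p_prime (fun r => if (0 < r < c)%N then f r else 0)).
  rewrite -(big_mkord xpredT (fun r => if (0 < r < c)%N then f r else 0)).
  have c_le : (c <= p)%N := ltnW (ltn_Fp p_prime c).
  rewrite (big_ltn (prime_gt0 p_prime)) /= add0r (big_nat_widen _ _ _ _ _ c_le).
  rewrite [RHS]big_mkcond.
  by apply: eq_big_nat => r /andP[r1 _]; rewrite r1.
by move=> r _; rewrite lt0n.
Qed.

(** * Summation over the Jacobi sums *)

Section SumOverJacobi.

Variables (p N n : nat) (p_prime : prime p) (N_prime : prime N).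
Hypotheses (p_gt3 : (3 < p)%N) (N_eq : N.-1 = (p * n)%N).
Let p_gt2 : (2 < p)%N := ltnW p_gt3.
Variables (z : 'F_N) (zeta : algC).
Hypotheses (zP : p.-primitive_root z) (zetaP : p.-primitive_root zeta).
Variables (a b : int).
Hypotheses (az : a%:~R + b%:~R * z = 0) (b_neq0 : b%:~R != 0 :> 'F_N).
Hypothesis ab_neq0 : (a + b)%:~R != 0 :> 'F_p.
Hypothesis normN :
  \prod_(k : 'F_p | k != 0) (a%:~R + b%:~R * zeta ^+ k) = N%:R :> algC.
Variable L : 'F_N -> 'F_p.
Hypothesis LM : forall x y, x != 0 -> y != 0 -> L (x * y) = L x + L y.

Let zp : z ^+ p = 1 := prim_expr_order zP.

Definition weight (j : 'F_p) : 'F_p := 6 * j ^+ 2 - 6 * j + 1.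

Lemma sum_weight_nat (R : comNzRingType) (k : R) (c : nat) :
  \sum_(1 <= r < c.+1) (6 * (r%:R * k) ^+ 2 - 6 * (r%:R * k) + 1)
    = c%:R * (k ^+ 2 * (c%:R + 1) * (2 * c%:R + 1) - 3 * k * (c%:R + 1) + 1).
Proof.
elim: c => [|c IHc]; first by rewrite big_nil mul0r.
by rewrite big_nat_recr //= IHc -natr1; ring.
Qed.

(** Put j = r k and c = <1/k>: the conditions become 0 < r < c, and j != 1 is then automatic. The
    closed form of [sum_weight_nat] at c - 1 simplifies to k - 1 because c k = 1. *)
Lemma sum_weight_half (k : 'F_p) : k != 0 ->
  \sum_(j : 'F_p | (j != 0) && (j != 1) && half_system j k) weight j = k - 1.
Proof.
move=> k0; rewrite (reindex_inj (mulIf k0)) /=.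
have c0 : k^-1 != 0 by rewrite invr_eq0.
rewrite (eq_bigl (fun r : 'F_p => (r != 0) && (r < k^-1)%N)); last first.
  move=> r; rewrite mulf_eq0 (negPf k0) orbF /half_system mulfK // -andbA; congr (_ && _).
  rewrite andb_idl // => rk; apply: contraTneq rk => rk1.
  by rewrite -[r](mulfK k0) rk1 mul1r ltnn.
rewrite (eq_bigr (fun r : 'F_p =>
    6 * ((r : nat)%:R * k) ^+ 2 - 6 * ((r : nat)%:R * k) + 1));
  last by move=> r _; rewrite natr_Fp.
rewrite (sum_Fp_interval (fun r => 6 * (r%:R * k) ^+ 2 - 6 * (r%:R * k) + 1)) //.
have c_gt0 : (0 < k^-1)%N by rewrite lt0n.
rewrite -[X in \sum_(1 <= r < X) _](prednK c_gt0) sum_weight_nat.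
have -> : (k^-1).-1%:R = k^-1 - 1 :> 'F_p.
  by rewrite -subn1 natrB // natr_Fp.
by field.
Qed.

Lemma sum_weight_log_binomial :
  \sum_(j : 'F_p | (j != 0) && (j != 1)) weight j * L 'C(n * j, n)%:R
  = \sum_(k : 'F_p | k != 0)
      (k - 1) * (L (a%:~R + b%:~R * z ^+ k) - b%:~R / (a + b)%:~R * k * L z).
Proof.
transitivity (\sum_(j : 'F_p | (j != 0) && (j != 1))
    \sum_(k : 'F_p | (k != 0) && half_system j k)
  weight j * (L (a%:~R + b%:~R * z ^+ k) - b%:~R / (a + b)%:~R * k * L z)).
  apply: eq_bigr => j /andP[j0 j1].
  rewrite (log_binomial p_prime N_prime p_gt2 N_eq zP zetaP j0 j1 az b_neq0
    ab_neq0 normN LM).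
  by rewrite mulr_sumr.
rewrite (exchange_big_dep (fun k => k != 0)) /=; last by move=> j k _ /andP[].
apply: eq_bigr => k k0; rewrite -(sum_weight_half k0) mulr_suml.
by apply: eq_bigl => j; rewrite k0.
Qed.

(** Substituting 2 k for k multiplies the sum by 4, and 3 is invertible since p > 3. *)
Lemma sum_Fp_sqr : \sum_(k : 'F_p) k ^+ 2 = 0.
Proof.
have two0 := natr_Fp_neq0_2 p_prime p_gt2.
have three0 : 3%:R != 0 :> 'F_p by rewrite natr_Fp_eq0 // dvdn_prime2 // gtn_eqF.
apply: (mulfI three0); rewrite mulr0.
have : \sum_(k : 'F_p) k ^+ 2 = 4 * \sum_(k : 'F_p) k ^+ 2.
  rewrite {1}(reindex_inj (mulfI two0)) mulr_sumr; apply: eq_bigr => k _ /=; ring.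
by set S := \sum_(k : 'F_p) _ => SE; rewrite -[RHS](subrr S) {2}SE; ring.
Qed.

(** Pair l with -l: from z^(-l) - 1 = - z^(-l) (z^l - 1), twice the sum is L(z) times the sum of the
    l^2, which is 0. *)
Lemma sum_log_zeta_sub1 : \sum_(l : 'F_p | l != 0) l * L (z ^+ l - 1) = 0.
Proof.
have inv : \sum_(l : 'F_p | l != 0) l * L (z ^+ l - 1)
         = \sum_(l : 'F_p | l != 0) - l * L (z ^+ (- l)%R - 1).
  by rewrite (reindex_inj oppr_inj); apply: eq_bigl => l; rewrite oppr_eq0.
apply: (Fp_double_eq0 p_prime p_gt2); rewrite {2}inv.
rewrite -big_split -[RHS](mulr0 (L z)) -[in RHS]sum_Fp_sqr mulr_sumr.
rewrite [RHS](bigD1 0) //= expr0n mulr0 add0r; apply: eq_bigr => l l0.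
have zl1 : z ^+ l - 1 != 0.
  rewrite subr_eq0; apply: contra_neq l0 => zl.
  by apply: (expr_Fp_inj p_prime zP); rewrite /= zl expr0.
have zNl0 : z ^+ (- l)%R != 0 by rewrite expf_neq0 // (z_neq0 p_prime zP).
have -> : z ^+ (- l)%R - 1 = - (z ^+ (- l)%R * (z ^+ l - 1)).
  by rewrite mulrBr -expr_FpD // addNr expr0 mulr1 opprB.
rewrite (logN p_prime p_gt2 LM) ?mulf_neq0 // LM //.
by rewrite (logX LM) ?(z_neq0 p_prime zP) // natr_Fp; ring.
Qed.

(** The terms in L z carry k^2 - k and cancel. Moving L(a + b) to the left supplies the missing term
    k = 0, of weight -1. With k = l + 1 the argument is b z (z^l - 1) and the weight is l, so the
    undefined logarithm at l = 0 has weight 0. *)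
Lemma sum_log_factor :
  \sum_(k : 'F_p | k != 0)
      (k - 1) * (L (a%:~R + b%:~R * z ^+ k) - b%:~R / (a + b)%:~R * k * L z)
  = L (a + b)%:~R.
Proof.
have aE : a%:~R = - (b%:~R * z) by apply/eqP; rewrite -addr_eq0 az.
under eq_bigr do rewrite mulrBr; rewrite sumrB.
have -> : \sum_(k : 'F_p | k != 0) (k - 1) * (b%:~R / (a + b)%:~R * k * L z) = 0.
  transitivity (b%:~R / (a + b)%:~R * L z * \sum_(k : 'F_p | k != 0) (k ^+ 2 - k)).
    by rewrite mulr_sumr; apply: eq_bigr => k _; ring.
  rewrite sumrB; have := sum_Fp_sqr; rewrite (bigD1 0) //= expr0n add0r => ->.
  have := sum_Fp_id p_prime p_gt2; rewrite (bigD1 0) //= add0r => ->.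
  by rewrite subrr mulr0.
have -> : L (a + b)%:~R = L (a%:~R + b%:~R * z ^+ (0%R : 'F_p)).
  by rewrite expr0 mulr1 rmorphD.
rewrite subr0; apply/eqP; rewrite -subr_eq0; apply/eqP.
transitivity (\sum_(k : 'F_p) (k - 1) * L (a%:~R + b%:~R * z ^+ k)).
  by rewrite [RHS](bigD1 0) //= addrC; congr (_ + _); rewrite sub0r mulN1r.
rewrite (reindex_inj (addIr 1)) /= (bigD1 0) //= add0r subrr mul0r add0r.
rewrite (eq_bigr (fun l : 'F_p => l * (L b%:~R + L z) + l * L (z ^+ l - 1))).
  rewrite big_split /= -mulr_suml sum_log_zeta_sub1 addr0.
  have := sum_Fp_id p_prime p_gt2; rewrite (bigD1 0) //= add0r => ->.
  by rewrite mul0r.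
move=> l l0; rewrite addrK -mulrDr.
have zl1 : z ^+ l - 1 != 0.
  rewrite subr_eq0; apply: contra_neq l0 => zl.
  by apply: (expr_Fp_inj p_prime zP); rewrite /= zl expr0.
have z0 := z_neq0 p_prime zP.
rewrite -!LM ?mulf_neq0 //; congr (_ * L _).
by rewrite expr_FpD // (expr_Fp_nat p_prime 1 zp) aE; ring.
Qed.

End SumOverJacobi.

(** * The sum of k log k *)

Lemma sum_nat_symmetric (V : nmodType) (h : nat) (g : nat -> V) :
    (forall k, (0 < k < h.*2.+1)%N -> g (h.*2.+1 - k)%N = g k) ->
  \sum_(1 <= k < h.*2.+1) g k = (\sum_(1 <= k < h.+1) g k) *+ 2.
Proof.
move=> gN; rewrite (@big_cat_nat _ _ _ h.+1) //=; last by lia.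
rewrite mulr2n; congr (_ + _); rewrite -[X in \sum_(X <= _ < _) _]add1n big_addn.
rewrite (_ : h.*2.+1 - h = h.+1)%N; last by lia.
rewrite [LHS]big_nat_rev; apply: eq_big_nat => k k_bd; rewrite -[RHS]gN; last by lia.
by congr g; lia.
Qed.

(** The reflection k |-> 2 h + 1 - k exchanges odd and even indices. *)
Lemma sum_nat_symmetric_even (V : nmodType) (h : nat) (g : nat -> V) :
    (forall k, (0 < k < h.*2.+1)%N -> g (h.*2.+1 - k)%N = g k) ->
  \sum_(1 <= k < h.*2.+1) g k = (\sum_(1 <= k < h.+1) g k.*2) *+ 2.
Proof.
move=> gN; rewrite mulr2n.
have -> : \sum_(1 <= k < h.*2.+1) g k
    = \sum_(1 <= k < h.+1) g k.*2 + \sum_(1 <= k < h.+1) g k.*2.-1.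
  elim: h {gN} => [|h IHh]; first by rewrite !big_nil addr0.
  rewrite doubleS 2?big_nat_recr //= IHh [in RHS]big_nat_recr //=.
  rewrite [X in _ = _ + X]big_nat_recr //= doubleS /=.
  by rewrite [RHS]addrACA -addrA [g _.+1 + _]addrC.
congr (_ + _); rewrite [LHS]big_nat_rev /=; apply: eq_big_nat => k k_bd.
by rewrite -[RHS]gN; [congr g; lia | lia].
Qed.

Section Sums.

Variables (p N n : nat) (p_prime : prime p) (N_prime : prime N).
Hypotheses (p_gt3 : (3 < p)%N) (N_eq : N.-1 = (p * n)%N).
Let p_gt2 : (2 < p)%N := ltnW p_gt3.
Variable L : 'F_N -> 'F_p.
Hypothesis LM : forall x y, x != 0 -> y != 0 -> L (x * y) = L x + L y.

Let NE : N = (p * n).+1.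
Proof. by rewrite -N_eq prednK ?prime_gt0. Qed.

Let natr_N : N%:R = 1 :> 'F_p.
Proof. by rewrite NE -natr1 natrM (natr_p p_prime) mul0r add0r. Qed.

Let natr_neq0 (k : nat) : (0 < k < N)%N -> k%:R != 0 :> 'F_N.
Proof. by case/andP=> k0 kN; rewrite natr_Fp_eq0 // gtnNdvd. Qed.

Let logMn (k l : nat) : (0 < k < N)%N -> (0 < l < N)%N ->
  L (k * l)%:R = L k%:R + L l%:R.
Proof. by move=> kN lN; rewrite natrM LM ?natr_neq0. Qed.

Let logNn (k : nat) : (0 < k < N)%N -> L (N - k)%:R = L k%:R.
Proof.
move=> kN; rewrite natrB; last by lia.
by rewrite (natr_p N_prime) sub0r (logN p_prime p_gt2 LM) ?natr_neq0.
Qed.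

(* B_2(k) - 1/6, where B_2 is the second Bernoulli polynomial; the [weight] above
   is 6 B_2. *)
Definition b2 (R : nzRingType) (k : nat) : R := k%:R ^+ 2 - k%:R.

Lemma sum_b2 (R : comNzRingType) (m : nat) :
  3 * \sum_(k < m) b2 R k = m%:R * (m%:R - 1) * (m%:R - 2).
Proof.
elim: m => [|m IHm]; first by rewrite big_ord0 mulr0 !mul0r.
by rewrite big_ord_recr /= mulrDr IHm /b2 -natr1; ring.
Qed.

Lemma sum_b2_N : \sum_(1 <= k < N) b2 'F_p k = 0.
Proof.
have three0 : 3%:R != 0 :> 'F_p by rewrite natr_Fp_eq0 // dvdn_prime2 // gtn_eqF.
apply: (mulfI three0); rewrite mulr0.
transitivity (3 * \sum_(k < N) b2 'F_p k); last first.
  by rewrite sum_b2 natr_N subrr mulr0 mul0r.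
congr (_ * _); rewrite -(big_mkord xpredT (b2 'F_p)) [RHS]big_ltn ?prime_gt0 //.
by rewrite /b2 expr0n subrr add0r.
Qed.

Definition log_b2_sum : 'F_p := \sum_(1 <= k < N) b2 'F_p k * L k%:R.

(** Let U be [log_b2_sum], and let A and S be the sums of k^2 L(k) and k L(k) for k up to h = (N -
    1) / 2. Since N = 1 modulo p, the weight k^2 - k is invariant under k |-> N - k, so U = 2 (A -
    S). Keeping the even indices instead gives U = 8 A - 4 S, the coefficient of L(2) being 0 by
    [sum_b2_N]. Hence 6 A = 2 S and 6 U = -8 S. *)
Lemma log_b2_sum_half :
  6 * log_b2_sum = - 8 * \sum_(1 <= k < ((N - 1) %/ 2).+1) k%:R * L k%:R.
Proof.
have [h Nh] : exists h, N = h.*2.+1.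
  exists (N./2); have : odd N.
    case: (even_prime N_prime) => // N2; have /esym/eqP := N_eq.
    by rewrite N2 /= muln_eq1 => /andP[/eqP p1]; move: p_gt3; rewrite p1.
  by move=> N_odd; rewrite -[LHS]odd_double_half N_odd.
have -> : ((N - 1) %/ 2 = h)%N by rewrite Nh subn1 /= -muln2 mulnK.
have b2N k : (0 < k < h.*2.+1)%N -> b2 'F_p (h.*2.+1 - k) = b2 'F_p k.
  rewrite -Nh => kN; rewrite /b2 natrB; last by lia.
  by rewrite natr_N; ring.
have b2LN k : (0 < k < h.*2.+1)%N ->
    b2 'F_p (h.*2.+1 - k) * L (h.*2.+1 - k)%:R = b2 'F_p k * L k%:R.
  by move=> kN; rewrite b2N // -Nh logNn // Nh.
have even0 := sum_b2_N; rewrite Nh (sum_nat_symmetric_even b2N) in even0.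
have U1 := sum_nat_symmetric b2LN; have U2 := sum_nat_symmetric_even b2LN.
rewrite -Nh -/log_b2_sum in U1 U2.
set S := \sum_(1 <= k < h.+1) _; pose A := \sum_(1 <= k < h.+1) k%:R ^+ 2 * L k%:R.
have U1' : log_b2_sum = 2 * (A - S).
  rewrite U1 [RHS]mulr_natl; congr (_ *+ _); rewrite -sumrB; apply: eq_bigr => k _.
  by rewrite /b2 mulrBl.
have U2' : log_b2_sum = 8 * A - 4 * S.
  have -> : 8 * A - 4 * S = 2 * (4 * A - 2 * S) by ring.
  rewrite U2 [RHS]mulr_natl; congr (_ *+ _).
  transitivity (\sum_(1 <= k < h.+1) (4 * (k%:R ^+ 2 * L k%:R) - 2 * (k%:R * L k%:R)
     + b2 'F_p k.*2 * L 2%:R)).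
    apply: eq_big_nat => k kh; rewrite -mul2n logMn; [|lia|lia].
    by rewrite /b2 natrM; ring.
  rewrite big_split /= sumrB -!mulr_sumr -mulr_suml.
  move/eqP: even0; rewrite -[X in X == _]mulr_natr mulf_eq0.
  rewrite (negPf (natr_Fp_neq0_2 p_prime p_gt2)) orbF.
  by move/eqP => ->; rewrite mul0r addr0.
have SA : 6 * A = 2 * S.
  have : 8 * A - 4 * S = 2 * (A - S) by rewrite -U2'.
  move=> /eqP; rewrite -subr_eq0 => /eqP AS0.
  by apply/eqP; rewrite -subr_eq0 -AS0; apply/eqP; ring.
rewrite U1'; have -> : 6 * (2 * (A - S)) = 2 * (6 * A) - 12 * S by ring.
by rewrite SA; ring.
Qed.

Lemma sum_weight_succ_nat (R : comNzRingType) (m : nat) :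
  \sum_(i < m) (6 * i%:R ^+ 2 + 6 * i%:R + 1) = m%:R * (2 * m%:R ^+ 2 - 1) :> R.
Proof.
elim: m => [|m IHm]; first by rewrite big_ord0 mul0r.
by rewrite big_ord_recr /= IHm -natr1; ring.
Qed.

Let n_gt0 : (0 < n)%N.
Proof. by rewrite lt0n; apply: contraTneq (prime_gt1 N_prime) => n0; lia. Qed.

(* Modulo p one has N = 1, so floor(p k / N) = - (p k mod N). *)
Lemma log_b2_sum_floor :
  log_b2_sum = \sum_(1 <= k < N)
    (((p * k) %/ N)%:R ^+ 2 + ((p * k) %/ N)%:R) * L k%:R.
Proof.
have p0 : p%:R != 0 :> 'F_N.
  by rewrite natr_neq0 // prime_gt0 //= NE ltnS leq_pmulr.
have b2p (x : 'F_N) : b2 'F_p (p%:R * x : 'F_N)%R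
    = ((p * x) %/ N)%:R ^+ 2 + ((p * x) %/ N)%:R.
  have -> : p%:R * x = (p * x)%:R :> 'F_N by rewrite natrM natr_Fp.
  rewrite /b2 val_Fp_nat //; have := congr1 (fun k => k%:R : 'F_p) (divn_eq (p * x) N).
  rewrite /= natrM natrD natrM natr_N mulr1 (natr_p p_prime) mul0r => /esym/eqP.
  by rewrite addrC addr_eq0 => /eqP ->; ring.
(* This removes the L(p) produced by substituting p x for x. *)
have sum0 : \sum_(x : 'F_N | x != 0) b2 'F_p (p%:R * x : 'F_N)%R = 0.
  transitivity (\sum_(x : 'F_N | x != 0) b2 'F_p x).
    rewrite [RHS](reindex_inj (mulfI p0)) /=.
    by apply: eq_bigl => x; rewrite mulf_eq0 (negPf p0).
  by rewrite (sum_Fp_neq0 N_prime (b2 'F_p)) sum_b2_N.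
rewrite /log_b2_sum -!(sum_Fp_neq0 N_prime (fun k => _ * L k%:R)).
rewrite [LHS](reindex_inj (mulfI p0)) /=.
transitivity (\sum_(x : 'F_N | x != 0) (b2 'F_p (p%:R * x : 'F_N)%R * L x +
    b2 'F_p (p%:R * x : 'F_N)%R * L p%:R)).
  apply: eq_big => [x|x]; rewrite mulf_eq0 (negPf p0) //= => x0.
  by rewrite natr_Fp LM // mulrDr addrC.
rewrite big_split /= -mulr_suml sum0 mul0r addr0.
by apply: eq_bigr => x _; rewrite b2p natr_Fp.
Qed.

Definition logfact (m : nat) : 'F_p := L m`!%:R.

Lemma fact_neq0 (m : nat) : (m < N)%N -> m`!%:R != 0 :> 'F_N.
Proof.
elim: m => [|m IHm] mN; first by rewrite oner_neq0.
rewrite factS natrM; apply: mulf_neq0; first exact: natr_neq0.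
exact: IHm (ltnW mN).
Qed.

Lemma logfactS (m : nat) : (m.+1 < N)%N -> logfact m.+1 = L m.+1%:R + logfact m.
Proof.
move=> mN; rewrite /logfact factS natrM LM //; first exact: natr_neq0.
exact: fact_neq0 (ltnW mN).
Qed.

Lemma log_bin (m k : nat) : (m + k < N)%N ->
  L 'C(m + k, k)%:R = logfact (m + k) - logfact m - logfact k.
Proof.
move=> mkN; have := bin_fact (leq_addl m k); rewrite addnK.
move/(congr1 (fun x => x%:R : 'F_N)); rewrite !natrM => E.
have f0 := fact_neq0 mkN.
have [C0 k0 m0] :
    [/\ 'C(m + k, k)%:R != 0 :> 'F_N, k`!%:R != 0 :> 'F_N & m`!%:R != 0 :> 'F_N].
  by move: f0; rewrite -E !mulf_eq0 !negb_or => /and3P[].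
by rewrite /logfact -E !LM ?mulf_neq0 //; ring.
Qed.

Lemma logfact_pred : logfact N.-1 = 0.
Proof.
rewrite /logfact; have := Wilson (prime_gt1 N_prime).
rewrite N_prime => /esym; rewrite -(natr_Fp_eq0 N_prime) -natr1 addr_eq0 => /eqP ->.
exact: (logN1 p_prime p_gt2 LM).
Qed.

Lemma bin_pred_modN (k : nat) : (k <= N.-1)%N ->
  'C(N.-1, k)%:R = (-1) ^+ k :> 'F_N.
Proof.
elim: k => [|k IHk] kN; first by rewrite bin0.
have kN' : (k < N)%N by rewrite -(prednK (prime_gt0 N_prime)) ltnS ltnW.
have : 'C(N, k.+1)%:R = 0 :> 'F_N.
  apply/eqP; rewrite natr_Fp_eq0 // prime_dvd_bin //=.
  by rewrite -(prednK (prime_gt0 N_prime)) ltnS.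
have -> : 'C(N, k.+1) = ('C(N.-1, k.+1) + 'C(N.-1, k))%N.
  by rewrite -{1}(prednK (prime_gt0 N_prime)) binS.
rewrite natrD IHk 1?ltnW // => /eqP.
by rewrite addr_eq0 => /eqP ->; rewrite exprS mulN1r.
Qed.

Lemma log_bin_pred : L 'C(n * p, n)%:R = 0.
Proof.
rewrite mulnC -N_eq bin_pred_modN; last by rewrite N_eq leq_pmull ?prime_gt0.
by rewrite (logX LM) ?oppr_eq0 ?oner_neq0 // (logN1 p_prime p_gt2 LM) mulr0.
Qed.

Lemma log_b2_sum_blocks :
  log_b2_sum = \sum_(i < p) (i%:R ^+ 2 + i%:R) * (L 'C(n * i.+1, n)%:R + logfact n).
Proof.
rewrite log_b2_sum_floor {1}NE big_add1 /= big_nat_mul big_mkord.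
apply: eq_bigr => i _; have ip := ltn_ord i.
have bd : (n * i.+1 < N)%N by rewrite NE ltnS mulnC leq_mul2r ip orbT.
rewrite (eq_big_nat _ _ (F2 := fun k => (i%:R ^+ 2 + i%:R) *
    (logfact k.+1 - logfact k))); last first.
  move=> k /andP[ik ki].
  (* Write k = i n + r with r < n. Since p n = N - 1, p (k + 1) = i N + (p (r + 1) - i), with
     remainder in [0, N). *)
  have -> : ((p * k.+1) %/ N = i)%N.
    move: ki; rewrite mulSn -{1}(subnK ik) ltn_add2r; set r := (k - _)%N => rn.
    have ipr : (i <= p * r.+1)%N by rewrite (leq_trans (ltnW ip)) // leq_pmulr.
    have -> : (p * k.+1 = i * N + (p * r.+1 - i))%N.
      have -> : k = (i * n + r)%N by rewrite subnKC.
      apply: (@addIn i); rewrite -[RHS]addnA subnK // NE; ring.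
    rewrite divnMDl ?prime_gt0 // divn_small ?addn0 // NE ltnS.
    by rewrite (leq_trans (leq_subr _ _)) // leq_mul2l rn orbT.
  congr (_ * _); rewrite logfactS ?addrK //.
  by apply: leq_ltn_trans bd; rewrite mulnC.
rewrite -mulr_sumr telescope_sumr; last by rewrite leq_mul2r leqnSn orbT.
have E : (n * i.+1 = i * n + n)%N by rewrite mulnC mulSn addnC.
by rewrite E log_bin -?E // -[(i.+1 * n)%N]mulnC subrK.
Qed.

(** With j = i + 1, 6 (i^2 + i) + 1 is the weight of j. The extra 1 costs nothing, as the blocks add
    up to log (N - 1)! - log 0! = 0 (Wilson); the copies of log n! cancel because the weights add up
    to p (2 p^2 - 1) = 0. The end terms j = 1 and j = p drop out, their binomial coefficients being
    1 and a sign modulo N. *)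
Lemma log_b2_sum_weight :
  6 * log_b2_sum
    = \sum_(j : 'F_p | (j != 0) && (j != 1)) weight j * L 'C(n * j, n)%:R.
Proof.
have blocks0 : \sum_(i < p) (L 'C(n * i.+1, n)%:R + logfact n) = 0.
  transitivity (\sum_(i < p) (logfact (i.+1 * n) - logfact (i * n))).
    apply: eq_bigr => i _.
    have E : (n * i.+1 = i * n + n)%N by rewrite mulnC mulSn addnC.
    have bd : (n * i.+1 < N)%N by rewrite NE ltnS mulnC leq_mul2r (ltn_ord i) orbT.
    by rewrite E log_bin -?E // -[(i.+1 * n)%N]mulnC subrK.
  rewrite -(big_mkord xpredT (fun i => logfact (i.+1 * n) - logfact (i * n))).
  rewrite (telescope_sumr (fun i => logfact (i * n))) // mul0n -N_eq logfact_pred.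
  by rewrite /logfact fact0 (log1 LM) subrr.
pose f j := (6 * j%:R ^+ 2 - 6 * j%:R + 1) * L 'C(n * j, n)%:R.
have sum_f : \sum_(i < p) f i.+1 = \sum_(j : 'F_p | (j != 0) && (j != 1)) f j.
  have -> : \sum_(i < p) f i.+1 = \sum_(1 <= j < p.+1) f j.
    by rewrite big_add1 big_mkord.
  rewrite big_nat_recr ?prime_gt0 //= [f p]/f log_bin_pred mulr0 addr0.
  rewrite -(sum_Fp_neq0 p_prime f) (bigD1 1) ?oner_neq0 //=.
  by rewrite {1}/f val_Fp1 // muln1 binn (log1 LM) mulr0 add0r.
have -> : \sum_(j : 'F_p | (j != 0) && (j != 1)) weight j * L 'C(n * j, n)%:R
   = \sum_(i < p) f i.+1.
  by rewrite sum_f; apply: eq_bigr => j _; rewrite /f natr_Fp.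
have w0 : \sum_(i < p) (6 * i%:R ^+ 2 + 6 * i%:R + 1) = 0 :> 'F_p.
  by rewrite sum_weight_succ_nat (natr_p p_prime) mul0r.
transitivity (6 * log_b2_sum + \sum_(i < p) (L 'C(n * i.+1, n)%:R + logfact n)).
  by rewrite blocks0 addr0.
transitivity (\sum_(i < p) f i.+1 +
    (\sum_(i < p) (6 * i%:R ^+ 2 + 6 * i%:R + 1)) * logfact n); last first.
  by rewrite w0 mul0r addr0.
rewrite log_b2_sum_blocks mulr_sumr mulr_suml -!big_split /=.
by apply: eq_bigr => i _; rewrite /f -natr1; ring.
Qed.

End Sums.

(** * Consequences of N = (a^p + b^p) / (a + b) *)

Section CyclotomicPrime.

Variables (p N : nat) (p_prime : prime p) (N_prime : prime N).
Hypotheses (p_gt2 : (2 < p)%N) (N_modp : N%:R = 1 :> 'F_p).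
Variables (a b : int).
Hypothesis N_sum : N%:R = \sum_(i < p) a ^+ (p.-1 - i) * (- b) ^+ i.

Let N_sumR (R : comNzRingType) :
  N%:R = \sum_(i < p) a%:~R ^+ (p.-1 - i) * (- b%:~R) ^+ i :> R.
Proof.
have := congr1 (fun x : int => x%:~R : R) N_sum; rewrite /= natz -pmulrn => ->.
rewrite rmorph_sum; apply: eq_bigr => i _.
by rewrite rmorphM !rmorphXn rmorphN.
Qed.

Let N_sum_diag (R : comNzRingType) :
  a%:~R + b%:~R = 0 :> R -> N%:R = p%:R * a%:~R ^+ p.-1 :> R.
Proof.
move=> ab0; have bE : - b%:~R = a%:~R :> R by apply/esym/eqP; rewrite -addr_eq0 ab0.
rewrite N_sumR bE (eq_bigr (fun=> a%:~R ^+ p.-1)) => [|i _].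
  by rewrite sumr_const card_ord mulr_natl.
by rewrite -exprD subnK // -ltnS prednK ?prime_gt0.
Qed.

(** If a = -b modulo p, all terms of the sum agree and N = p a^(p-1) = 0 modulo p. *)
Lemma sum_neq0_modp : (a + b)%:~R != 0 :> 'F_p.
Proof.
apply/eqP; rewrite rmorphD /= => /N_sum_diag; rewrite N_modp (natr_p p_prime) mul0r.
by move/eqP; rewrite oner_eq0.
Qed.

(** If N divides b then it divides a^(p-1), hence a; the sum is homogeneous of degree p - 1 >= 2, so
    N^2 would divide N. *)
Lemma b_neq0_modN : b%:~R != 0 :> 'F_N.
Proof.
have p1_gt0 : (0 < p.-1)%N by rewrite -ltnS prednK ?prime_gt0 // ltnW.
have Ndvd (x : int) : (x%:~R == 0 :> 'F_N) = (N %| x)%Z.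
  by rewrite (dvdz_pcharf (pchar_Fp N_prime)).
apply/negP => b0; have a0 : a%:~R == 0 :> 'F_N.
  have := N_sumR 'F_N; rewrite (natr_p N_prime) (eqP b0) oppr0.
  rewrite (bigD1 (Ordinal (prime_gt0 p_prime))) //= expr0 mulr1 subn0.
  rewrite big1 ?addr0 => [|i i0]; last first.
    by rewrite expr0n (negPf (i0 : nat_of_ord i != 0%N)) mulr0.
  by move/esym/eqP; rewrite expf_eq0 p1_gt0.
move: a0 b0; rewrite !Ndvd => /dvdzP[a' aE] /dvdzP[b' bE].
have : (N%:Z ^+ 2 %| N%:Z)%Z.
  rewrite -[X in (_ %| X)%Z]natz N_sum rpred_sum // => i _; have ip := ltn_ord i.
  rewrite aE bE -mulNr !exprMn mulrACA -exprD subnK; last first.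
    by rewrite -ltnS prednK ?prime_gt0.
  rewrite dvdz_mull // dvdz_exp2l //.
  by rewrite -ltnS prednK ?prime_gt0.
rewrite dvdzE abszX !absz_nat => /(dvdn_leq (prime_gt0 N_prime)).
by rewrite leqNgt -{1}(expn1 N) ltn_exp2l // prime_gt1.
Qed.

(** Modulo N, a^p - (-b)^p = (a + b) N = 0. If the ratio were 1, then p a^(p-1) = N = 0, impossible
    because p != N and a = -b != 0. *)
Lemma ratio_root : p.-primitive_root (- a%:~R / b%:~R : 'F_N).
Proof.
have b0 := b_neq0_modN; have pN0 : p%:R != 0 :> 'F_N.
  rewrite natr_Fp_eq0 // dvdn_prime2 //; apply: contra_eq_neq N_modp => ->.
  by rewrite (natr_p p_prime) eq_sym oner_neq0.
have zE : - a%:~R / b%:~R = a%:~R / (- b%:~R) :> 'F_N by rewrite invrN mulrN mulNr.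
apply: prime_primitive_root => //.
  rewrite zE expr_div_n; apply: (canLR (mulfK _)); first by rewrite expf_neq0 ?oppr_eq0.
  apply/eqP; rewrite mul1r -subr_eq0 subrXX -N_sumR.
  by rewrite (natr_p N_prime) mulr0.
apply: contraNneq b0 => z1; have aE : a%:~R = - b%:~R :> 'F_N.
  by apply: divr1_eq; rewrite -zE.
have := @N_sum_diag 'F_N; rewrite aE addNr (natr_p N_prime) => /(_ erefl)/esym/eqP.
by rewrite mulf_eq0 (negPf pN0) expf_eq0 oppr_eq0 => /andP[].
Qed.

(** Homogenise the factorisation of X^p - 1 at X = a / (-b), then cancel the factor a + b at k =
    0. *)
Lemma norm_linear (zeta : algC) : p.-primitive_root zeta -> a + b != 0 ->
  \prod_(k : 'F_p | k != 0) (a%:~R + b%:~R * zeta ^+ k) = N%:R :> algC.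
Proof.
move=> zetaP ab0; have b0 : b%:~R != 0 :> algC.
  by rewrite intr_eq0; apply: contraNneq b_neq0_modN => ->.
have ab0' : a%:~R + b%:~R != 0 :> algC by rewrite -rmorphD intr_eq0.
have := subrXX (a%:~R : algC) (- b%:~R) p; rewrite opprK -N_sumR => abN.
apply: (mulfI ab0'); rewrite -abN.
transitivity (\prod_(k : 'F_p) (a%:~R + b%:~R * zeta ^+ k)).
  by rewrite [RHS](bigD1 0) //= expr0 mulr1.
have p0 : (0 < p)%N := prime_gt0 p_prime.
have := congr1 (fun f => f.[a%:~R / - b%:~R]) (factor_Xn_sub_1 zetaP).
rewrite /= horner_prod big_mkord !hornerE => E.
transitivity (\prod_(k : 'F_p) (- b%:~R * (a%:~R / - b%:~R - zeta ^+ k))).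
  apply: eq_bigr => k _; rewrite mulrBr [_ * (_ / _)]mulrC divfK ?oppr_eq0 //.
  by rewrite mulNr opprK.
rewrite big_split /= prodr_const card_Fp //.
rewrite (big_Fp p_prime (fun k => a%:~R / - b%:~R - zeta ^+ k)).
have <- : (a%:~R / - b%:~R) ^+ p - 1 = \prod_(k < p) (a%:~R / - b%:~R - zeta ^+ k).
  by rewrite -E; apply: eq_bigr => k _; rewrite !hornerE.
by rewrite expr_div_n mulrBr mulr1 mulrC divfK // expf_neq0 // oppr_eq0.
Qed.

End CyclotomicPrime.

(** * The reduction modulo p of log, as a function on F_N *)

Section LogOfMorphism.

Variables (p N m : nat) (p_prime : prime p) (N_prime : prime N).
Hypotheses (m_gt1 : (1 < m)%N) (p_dvd_m : (p %| m)%N).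
Variable log : {morphism [set: {unit 'Z_N}] >-> 'Z_m}.

Let N_gt1 : (1 < N)%N := prime_gt1 N_prime.

Definition log_Fp (x : 'F_N) : 'F_p := (log_repr log (nat_of_ord x)%:Z)%:~R.

(** ['F_N] is ['Z_(pdiv N)], a type distinct from ['Z_N]; natural representatives carry residues
    across. *)
Lemma natr_int_FpN (x : int) : (nat_of_ord (x%:~R : 'F_N))%:R = x%:~R :> 'Z_N.
Proof.
have NZ : N%:~R = 0 :> 'Z_N by apply: pchar_Zp.
have NF : N%:~R = 0 :> 'F_N by apply: (natr_p N_prime).
have [k xk] : exists k : nat, x = (x %/ N)%Z * N + k%:Z.
  exists `|(x %% N)%Z|%N; rewrite gez0_abs ?modz_ge0 -?divz_eq //.
  by rewrite -lt0n prime_gt0.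
rewrite xk !rmorphD !rmorphM /= NZ NF !mulr0 !add0r.
by rewrite val_Fp_nat // Zp_nat_mod.
Qed.

Lemma log_Fp_int (x : int) : log_Fp x%:~R = (log_repr log x)%:~R.
Proof.
have E : (nat_of_ord (x%:~R : 'F_N))%:Z%:~R = x%:~R :> 'Z_N := natr_int_FpN x.
by rewrite /log_Fp /log_repr /unit_class E.
Qed.

Lemma unit_natr_FpN (x : 'F_N) : x != 0 -> (nat_of_ord x)%:R \is a @GRing.unit 'Z_N.
Proof.
move=> x0; rewrite unitZpE // prime_coprime // gtnNdvd ?ltn_Fp //.
by rewrite lt0n.
Qed.

Lemma val_unit_class (x : 'F_N) : x != 0 ->
  val (unit_class N (nat_of_ord x)%:Z) = (nat_of_ord x)%:R.
Proof. by move=> x0; rewrite /unit_class insubdK //; exact: unit_natr_FpN. Qed.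

Lemma log_FpM (x y : 'F_N) :
  x != 0 -> y != 0 -> log_Fp (x * y) = log_Fp x + log_Fp y.
Proof.
move=> x0 y0; rewrite /log_Fp /log_repr.
have -> : unit_class N (nat_of_ord (x * y))%:Z
    = (unit_class N (nat_of_ord x)%:Z * unit_class N (nat_of_ord y)%:Z)%g.
  apply: val_inj; rewrite /= !val_unit_class ?mulf_neq0 //.
  by rewrite -natrM -[in RHS]Zp_nat_mod // -val_Fp_nat // natrM !natr_Fp.
rewrite morphM ?inE //= -rmorphD /=; set u := log _; set v := log _.
(* The group law of ['Z_m] is addition modulo m, which is compatible with reduction modulo p as p
   divides m. *)
have -> : nat_of_ord (u * v)%g = ((u + v) %% m)%N.
  by rewrite -[LHS]/((u + v) %% (Zp_trunc m).+2)%N [X in (_ %% X)%N]Zp_cast.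
have modm k : (k %% m)%:R = k%:R :> 'F_p.
  have m0 : m%:R == 0 :> 'F_p by rewrite natr_Fp_eq0.
  by rewrite [in RHS](divn_eq k m) natrD natrM (eqP m0) mulr0 add0r.
by rewrite -!pmulrn modm natrD.
Qed.

End LogOfMorphism.

Theorem mainTheorem2 (p N : nat)
    (p_prime : prime p) (p_ge5 : (5 <= p)%N)
    (N_prime : prime N) (N_ge5 : (5 <= N)%N)
    (N_eq1 : (N = 1 %[mod p])%N)
    (log : {morphism [set: {unit 'Z_N}] >-> 'Z_(p ^ logn p (N - 1))})
    (log_surj : (log @* [set: {unit 'Z_N}])%g
                  = [set: 'Z_(p ^ logn p (N - 1))])
    (a b : int)
    (ab_neq0 : a + b != 0)
    (N_eq : N%:R = (a ^+ p + b ^+ p)%:~R / (a + b)%:~R :> rat) :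
  (log_repr log (a + b)
     = - 8%:Z * \sum_(1 <= k < ((N - 1) %/ 2).+1) k%:Z * log_repr log k%:Z
     %[mod p%:Z])%Z.
Proof.
have p_gt3 : (3 < p)%N by exact: ltnW.
have p_gt2 : (2 < p)%N by exact: ltnW.
have p_odd : odd p by case: (even_prime p_prime) => // p2; move: p_ge5; rewrite p2.
have p_dvd : (p %| N - 1)%N.
  by rewrite -eqn_mod_dvd ?prime_gt0 //; apply/eqP.
have N1_gt0 : (0 < N - 1)%N by rewrite subn_gt0 prime_gt1.
have logn_gt0 : (0 < logn p (N - 1))%N by rewrite logn_gt0 mem_primes p_prime N1_gt0.
have p_dvd_m : (p %| p ^ logn p (N - 1))%N.
  by rewrite -(prednK logn_gt0) expnS dvdn_mulr.
have m_gt1 : (1 < p ^ logn p (N - 1))%N.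
  by rewrite (leq_trans (prime_gt1 p_prime)) // dvdn_leq // expn_gt0 prime_gt0.
have N_modp : N%:R = 1 :> 'F_p by rewrite -(Fp_nat_mod p_prime) N_eq1 Fp_nat_mod.
have N_pred : N.-1 = (p * ((N - 1) %/ p))%N by rewrite mulnC divnK // subn1.
(* As p is odd, a^p + b^p = a^p - (-b)^p, which factors through a + b over Z. *)
have N_sum : N%:R = \sum_(i < p) a ^+ (p.-1 - i) * (- b) ^+ i.
  apply: (mulfI ab_neq0); have := subrXX a (- b) p.
  rewrite opprK exprNn -signr_odd p_odd mulN1r opprK => <-.
  apply: (@intr_inj rat); rewrite rmorphM /= natz -pmulrn N_eq mulrC divfK //.
  by rewrite intr_eq0.
have zP := ratio_root p_prime N_prime p_gt2 N_modp N_sum.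
have [zeta zetaP] := C_prim_root_exists (prime_gt0 p_prime).
have b0 := b_neq0_modN p_prime N_prime p_gt2 N_sum.
have ab0 := sum_neq0_modp p_prime N_modp N_sum.
have normN := norm_linear p_prime N_prime p_gt2 N_sum zetaP ab_neq0.
have az : a%:~R + b%:~R * (- a%:~R / b%:~R) = 0 :> 'F_N.
  by rewrite mulrC divfK // addrN.
have LM := log_FpM p_prime N_prime m_gt1 p_dvd_m log.
(* Both sides compute 6 [log_b2_sum]: one becomes -8 times the sum of k log k, the other log (a +
   b). *)
have := log_b2_sum_weight p_prime N_prime p_gt3 N_pred LM.
rewrite (log_b2_sum_half p_prime N_prime p_gt3 N_pred LM).
rewrite (sum_weight_log_binomial p_prime N_prime p_gt3 N_pred zP zetaP az b0
  ab0 normN LM).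
rewrite (sum_log_factor p_prime p_gt3 zP az b0 LM).
rewrite (log_Fp_int p N_prime log) => main.
apply/eqP; rewrite eqz_mod_dvd (dvdz_pcharf (pchar_Fp p_prime)) rmorphB /= -main.
rewrite subr_eq0 rmorphM rmorph_sum /=; apply/eqP; congr (_ * _).
apply: eq_bigr => k _; rewrite rmorphM /=; congr (_ * _).
by rewrite -(log_Fp_int p N_prime log).
Qed.
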